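(* Suppose $f$ satisfies assumptions (1)–(4) of the context. Then there exist constants $C=C(d,\alpha,f,K)>0$ and $C'=C'(d,\alpha,f,K)>0$ such that for all integers $n\ge1$ and all $x\in\Lambda_L$, $$\Bigl|p_n(0,x)-\frac1N\Bigr|\le C\,W^{-d}n^{-d/\alpha}+C'\,nW^{-K}.$$ In addition, if $nW^{-K}\ll N^{-1}$, then $p_n(0,x)\le C\bigl(W^{-d}n^{-d/\alpha}+N^{-1}\bigr)$.
   Context: $\Lambda_L=(\mathbb Z/L\mathbb Z)^d$ and $N=L^d$; $W>0$. For $f:\mathbb R^d\to\mathbb R$ define $$\sigma^2_{xy}=\frac1M\sum_{m\in\mathbb Z^d}f\Bigl(\frac{x-y+mL}{W}\Bigr),\qquad M=\sum_{m\in\mathbb Z^d}f(m/W),$$ and let $p_n(x,y)$ be the $n$-step transition probabilities of the Markov chain on $\Lambda_L$ with transition matrix $(\sigma_{xy}^2)$. Let $\hat f(\xi)=\int_{\mathbb R^d}f(u)e^{-2\pi i\xi\cdot u}du$. Assume there are constants $\alpha\in(0,2]$, $c_0>0$, $\varepsilon>0$ and $0<\rho<1$ with: 1. $f\ge0$ and $\int f=1$; 2. $|\hat f(\xi)|\le\exp(-c_0|\xi|^\alpha)$ for $|\xi|\le\varepsilon$; 3. $|\hat f(\xi)|\le\rho$ for $|\xi|>\varepsilon$; 4. $f$ is continuous, and for constants $T,K>d$ and $C_T,C_K>1$, $f(x)\le C_T(1+|x|)^{-T}$ and $|\hat f(\xi)|\le C_K(1+|\xi|)^{-K}$. *)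

(* Defs.v *)
From HB Require Import structures.
From mathcomp Require Import all_boot all_order all_algebra.
From mathcomp Require Import all_classical all_reals all_analysis.
Set Implicit Arguments. Unset Strict Implicit. Unset Printing Implicit Defensive.
Import Order.TTheory GRing.Theory Num.Theory.
Import numFieldNormedType.Exports.
Local Open Scope classical_set_scope.
Local Open Scope ring_scope.

Section Defs.
Variable R : realType.

Definition enorm (d : nat) (v : 'rV[R]_d) : R := Num.sqrt (\sum_(i < d) v 0 i ^+ 2).
Definition dotp (d : nat) (u v : 'rV[R]_d) : R := \sum_(i < d) u 0 i * v 0 i.

(* Lebesgue integral over R^d, written as the iterated one-dimensional
   Lebesgue integral (equal to the d-dimensional one for absolutely
   integrable functions, by Fubini). *)
Fixpoint iint (d : nat) : ('rV[R]_d -> R) -> R :=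
  match d with
  | 0 => fun g => g 0
  | d'.+1 => fun g =>
      Rintegral lebesgue_measure [set: R]
        (fun t : R => @iint d' (fun v : 'rV[R]_d' => g (row_mx (const_mx t : 'rV[R]_1) v)))
  end.

Definition fourier_re (d : nat) (f : 'rV[R]_d -> R) (xi : 'rV[R]_d) : R :=
  iint (fun u => f u * cos (2 * pi * dotp xi u)).
Definition fourier_im (d : nat) (f : 'rV[R]_d -> R) (xi : 'rV[R]_d) : R :=
  - iint (fun u => f u * sin (2 * pi * dotp xi u)).
Definition fourier_abs (d : nat) (f : 'rV[R]_d -> R) (xi : 'rV[R]_d) : R :=
  Num.sqrt (fourier_re f xi ^+ 2 + fourier_im f xi ^+ 2).

Definition zsum (d : nat) (g : 'rV[int]_d -> R) : R :=
  fine (\esum_(m in [set: 'rV[int]_d]) (g m)%:E)%E.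

(* The torus Lambda_L = (Z/LZ)^d, points with coordinates in {0,..,L-1} *)
Definition Lam (d L : nat) := {ffun 'I_d -> 'I_L}.
Definition lam0 (d L : nat) (hL : (0 < L)%N) : Lam d L := [ffun _ => Ordinal hL].

Definition Mnorm (d : nat) (f : 'rV[R]_d -> R) (W : R) : R :=
  zsum (fun m : 'rV[int]_d => f (\row_i ((m 0 i)%:~R / W))).

Definition sigma2 (d : nat) (f : 'rV[R]_d -> R) (L : nat) (W : R) (x y : Lam d L) : R :=
  zsum (fun m : 'rV[int]_d =>
        f (\row_i ((((x i : nat)%:Z - (y i : nat)%:Z + m 0 i * (L%:Z))%R)%:~R / W)))
  / Mnorm f W.

Fixpoint pn (d : nat) (f : 'rV[R]_d -> R) (L : nat) (W : R) (n : nat) (x y : Lam d L) : R :=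
  match n with
  | 0 => (x == y)%:R
  | n'.+1 => \sum_(z : Lam d L) pn f W n' x z * sigma2 f W z y
  end.

End Defs.

(* Main.v *)
Require Import Defs.
From HB Require Import structures.
From mathcomp Require Import all_boot all_order all_algebra.
From mathcomp Require Import all_classical all_reals all_analysis.
From mathcomp Require Import measurable_realfun complex.
From mathcomp Require Import ring lra zify.
Set Implicit Arguments. Unset Strict Implicit. Unset Printing Implicit Defensive.
Import Order.TTheory GRing.Theory Num.Theory.
Import numFieldNormedType.Exports.
Local Open Scope classical_set_scope.
Local Open Scope ring_scope.

(* The chain is a random walk on the torus, so N p_n(0, x) is the sum over the
   dual torus of phi(q)^n chi_q(x), and the trivial character contributes the 1.
   Poisson summation shows that phi(q) differs from the Fourier transform of f at
   - W q / L (q represented in [-L/2, L/2]^d) by O(W^-K).  As both have modulus at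
   most 1, |phi(q)|^n is at most |fhat(W q / L)|^n + O(n W^-K), and assumptions
   (2)-(4) bound |fhat(z)|^n by a constant times
   (1 + n^(1/alpha) |z|)^-K + n^(-d/alpha) (1 + |z|)^-K, whose sum over the
   nonzero q is O(N W^-d n^(-d/alpha)).  If W^-K is not small, the estimate is
   trivial.

   Only the following quantitative form of Poisson summation is needed: the
   lattice sum of g differs from the integral of g by at most the Cesaro means of
   the sum of |ghat| over the nonzero frequencies.  It comes from letting n tend
   to infinity in the integral of g against the product of Fejer kernels
   F_n(W u_i). *)

(** * Polynomial weights *)

(** Integrals over R^d are iterated one-dimensional ones, so domination has to pass to slices. A
    radial weight does not factor, but (1 + |u|)^-T is at most the product of the (1 +
    |u_i|)^(-T/d), and T > d says exactly that each factor is integrable on the line. The same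
    splitting with K > d makes the sums over frequencies converge coordinate by coordinate.

    Fejer kernels are at once finite trigonometric sums, so that integrating g against them gives a
    finite average of values of ghat with no inversion formula, and nonnegative kernels of mass 1/W
    on each cell around a point of Z / W, so that they concentrate there under bounds uniform in n.

    The final sum over frequencies must gain W^-d uniformly in L, and rho^n alone has no decay in z.
    So one of the n factors is replaced by its bound from (4), and the other n - 1 give the power of
    n. Near the origin the exponential is weakened to a power of order K, so that one lattice
    estimate serves both terms. *)

Section PowerWeight.
Variable R : realType.
Implicit Types (k s t a : R).

Definition pweight k t : R := (1 + `|t|) `^ (- k).

Lemma pweight_gt0 k t : 0 < pweight k t.
Proof. by apply: powR_gt0; rewrite ltr_pwDl. Qed.

Lemma pweight_ge0 k t : 0 <= pweight k t.
Proof. exact: ltW (pweight_gt0 _ _). Qed.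

Lemma pweight0 k : pweight k 0 = 1.
Proof. by rewrite /pweight normr0 addr0 powR1. Qed.

Lemma pweight_continuous k : continuous (pweight k).
Proof.
move=> t; rewrite /pweight /powR.
under eq_fun => x do rewrite gt_eqF ?ltr_pwDl//.
apply: continuous_comp; last exact: continuous_expR.
apply: cvgM; first exact: cvg_cst.
apply: (@continuous_comp _ _ _ (fun x : R => 1 + `|x|) (@ln R)).
  by apply: cvgD; [exact: cvg_cst|exact: norm_continuous].
by apply: continuous_ln; rewrite ltr_pwDl.
Qed.

(** The integral test without integrals: a tangent line inequality for t^(1 - k). After division by
    (a + s)^(1 - k) it reads 1 + (k - 1)(1 - r) <= r^(1 - k) with r = a / (a + s), which is exp x >=
    1 + x applied twice. *)
Lemma powR_telescope k s a : 1 < k -> 0 < s -> 0 < a ->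
  (k - 1) * s * (a + s) `^ (- k) <= a `^ (1 - k) - (a + s) `^ (1 - k).
Proof.
move=> k1 s0 a0; have b0 : 0 < a + s by rewrite addr_gt0.
have -> : (a + s) `^ (- k) = (a + s) `^ (1 - k) / (a + s).
  by rewrite powRD ?(gt_eqF b0) ?implybT// powRr1 ?ltW// mulrAC divff ?gt_eqF// mul1r.
have -> : a = a / (a + s) * (a + s) by rewrite divfK ?gt_eqF.
rewrite powRM; [|by rewrite divr_ge0// ltW|exact: ltW].
rewrite !divfK ?gt_eqF//.
set B := (a + s) `^ (1 - k).
have B0 : 0 < B by exact: powR_gt0.
suff : 1 + (k - 1) * (s / (a + s)) <= (a / (a + s)) `^ (1 - k).
  move=> h; rewrite -subr_ge0.
  have -> : (a / (a + s)) `^ (1 - k) * B - B - (k - 1) * s * (B / (a + s)) =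
    B * ((a / (a + s)) `^ (1 - k) - (1 + (k - 1) * (s / (a + s)))) by field; rewrite gt_eqF.
  by rewrite mulr_ge0 ?subr_ge0// ltW.
have r0 : 0 < a / (a + s) by rewrite divr_gt0.
rewrite /powR gt_eqF//; apply: le_trans (expR_ge1Dx _); rewrite lerD2l.
have h : 1 + ln (a / (a + s)) <= a / (a + s).
  by rewrite -[leRHS](lnK r0) expR_ge1Dx.
rewrite -[1 - k]opprB mulNr -mulrN ler_wpM2l ?subr_ge0 ?(ltW k1)//.
have -> : s / (a + s) = 1 - a / (a + s) by field; rewrite gt_eqF.
by rewrite lerNr opprB lerBrDl.
Qed.

Lemma sum_pweight_nat k s n : 1 < k -> 0 < s ->
  \sum_(i < n) pweight k (s * i.+1%:R) <= ((k - 1) * s)^-1.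
Proof.
move=> k1 s0; have c0 : 0 < (k - 1) * s by rewrite mulr_gt0 ?subr_gt0.
(* The telescoped remainder is kept on the right so that the induction closes. *)
suff : (k - 1) * s * \sum_(i < n) pweight k (s * i.+1%:R) <=
    1 - (1 + s * n%:R) `^ (1 - k).
  move=> h; rewrite -[leRHS]mulr1 -ler_pdivrMl ?invr_gt0// invrK.
  by apply: le_trans h _; rewrite gerBl powR_ge0.
elim: n => [|n IH]; first by rewrite big_ord0 mulr0 mulr0 addr0 powR1 subrr.
rewrite big_ord_recr/= mulrDr.
have /(powR_telescope k1 s0) : 0 < 1 + s * n%:R.
  by rewrite ltr_pwDl// mulr_ge0// ltW.
rewrite {2}/pweight (_ : 1 + `|_| = 1 + s * n%:R + s); last first.
  by rewrite ger0_norm ?(mulr_ge0 (ltW s0))// -natr1 mulrDr mulr1 addrA.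
rewrite (_ : 1 + s * n.+1%:R = 1 + s * n%:R + s); last first.
  by rewrite -natr1 mulrDr mulr1 addrA.
move=> h.
by rewrite (le_trans (lerD IH h))// addrA subrK.
Qed.

Lemma ler_sum_sub_seq (T : eqType) (F : T -> R) (r u : seq T) :
  (forall x, 0 <= F x) -> uniq r -> {subset r <= u} ->
  \sum_(x <- r) F x <= \sum_(x <- u) F x.
Proof.
move=> F0; elim: r u => [|x r IH] u /=; first by rewrite big_nil sumr_ge0.
move=> /andP[xr ur] ru; have xu : x \in u by apply: ru; rewrite mem_head.
rewrite big_cons (perm_big _ (perm_to_rem xu)) big_cons/= lerD2l IH// => y yr.
have /ru : y \in x :: r by rewrite in_cons yr orbT.
by rewrite (perm_mem (perm_to_rem xu)) in_cons => /predU1P[yx|//]; rewrite -yx yr in xr.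
Qed.

Lemma sum_pweight_int k s (r : seq int) : 1 < k -> 0 < s -> uniq r ->
  \sum_(y <- r) pweight k (s * y%:~R) <= 1 + 2 / ((k - 1) * s).
Proof.
move=> k1 s0 ur.
have [N hN] : exists N, forall y, y \in r -> (`|y| < N)%N.
  exists (\max_(y <- r) `|y|%N).+1 => y yr; rewrite ltnS.
  exact: (@leq_bigmax_seq _ r xpredT (fun y => `|y|%N)).
(* [Negz i] is -(i + 1), so both half-lines start at distance 1 and have the same sum. *)
pose u := 0 :: ([seq Posz i.+1 | i <- index_iota 0 N] ++ [seq Negz i | i <- index_iota 0 N]).
have ru : {subset r <= u}.
  move=> y yr.
  have yN := hN y yr.
  rewrite /u inE mem_cat; case: y yr yN => [[|i]|i] _ yN //=.
    by rewrite (map_f (fun i => Posz i.+1))// mem_index_iota/=; lia.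
  by rewrite (map_f Negz) ?orbT// mem_index_iota/=; lia.
apply: le_trans (ler_sum_sub_seq (fun=> pweight_ge0 _ _) ur ru) _.
rewrite /u big_cons big_cat/= mulr0 pweight0 lerD2l !big_map !big_mkord.
have h := sum_pweight_nat N k1 s0.
rewrite mulr_natl mulr2n lerD//; apply: le_trans h; apply: ler_sum => i _.
by rewrite /pweight NegzE mulrNz mulrN normrN.
Qed.

Lemma sum_pweight_inj k s (J : finType) (y : J -> int) : 1 < k -> 0 < s -> injective y ->
  \sum_(j : J) pweight k (s * (y j)%:~R) <= 1 + 2 / ((k - 1) * s).
Proof.
move=> k1 s0 yi; rewrite -big_enum -(big_map y predT (fun z => pweight k (s * z%:~R))).
by apply: sum_pweight_int => //; rewrite map_inj_uniq// enum_uniq.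
Qed.

Lemma esum_pweight k s : 1 < k -> 0 < s ->
  (\esum_(y in [set: int]) (pweight k (s * y%:~R))%:E <= (1 + 2 / ((k - 1) * s))%:E)%E.
Proof.
move=> k1 s0; apply: ge_ereal_sup => _ [A [fA _] <-].
rewrite fsbig_finite// sumEFin lee_fin.
by apply: sum_pweight_int => //; exact: finmap.fset_uniq.
Qed.

End PowerWeight.

(** * The Fejer kernel on the line *)

Section Fejer.
Variable R : realType.
Implicit Types (t : R) (n : nat).

Lemma sin_int_pi (z : int) : sin (z%:~R * pi) = 0 :> R.
Proof.
have h (k : nat) : sin (k%:R * pi) = 0 :> R.
  elim: k => [|k IH]; first by rewrite mul0r sin0.
  by rewrite -natr1 mulrDl mul1r sinD IH mul0r sinpi mulr0 addr0.
by case: z => k; [exact: h|rewrite NegzE mulrNz mulNr sinN h oppr0].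
Qed.

Lemma cos_int_pi (z : int) : cos (z%:~R * pi) ^+ 2 = 1 :> R.
Proof. by have := cos2Dsin2 (z%:~R * pi : R); rewrite sin_int_pi expr0n/= addr0. Qed.

Lemma sin2_int_shift (z : int) t : sin (pi * (t + z%:~R)) ^+ 2 = sin (pi * t) ^+ 2.
Proof.
rewrite mulrDr sinD [pi * z%:~R]mulrC sin_int_pi mulr0 addr0 exprMn.
by rewrite cos_int_pi mulr1.
Qed.

(** The squared modulus of the sum of e^(2 pi i j t) over j < n, divided by n: nonnegative by its
    form, of period 1, and of mean 1 for n > 0. For n = 0 it is 0, the inverse of 0 being 0. *)
Definition fejer n t : R := n%:R^-1 *
  ((\sum_(j < n) cos (2 * pi * (j%:R * t))) ^+ 2 +
   (\sum_(j < n) sin (2 * pi * (j%:R * t))) ^+ 2).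

Lemma fejer_ge0 n t : 0 <= fejer n t.
Proof. by rewrite mulr_ge0 ?invr_ge0// addr_ge0// sqr_ge0. Qed.

Lemma fejer1 t : fejer 1 t = 1.
Proof. by rewrite /fejer !big_ord1 mul0r mulr0 cos0 sin0 expr0n expr1n addr0 invr1 mulr1. Qed.

Lemma fejerE n t : fejer n t =
  n%:R^-1 * \sum_(j < n) \sum_(k < n) cos (2 * pi * ((j%:R - k%:R) * t)).
Proof.
rewrite /fejer !expr2 !big_distrlr/= -big_split/=; congr (_ * _).
apply: eq_bigr => j _; rewrite -big_split/=; apply: eq_bigr => k _.
by rewrite mulrBl mulrBr cosB.
Qed.

Lemma fejer_continuous n : continuous (fejer n).
Proof.
have cc (f : R -> R) : continuous f ->
    continuous (fun t => \sum_(j < n) f (2 * pi * (j%:R * t))).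
  move=> cf t; apply: cvg_big => [|j _]; first exact: add_continuous.
  apply: (@continuous_comp _ _ _ (fun x : R => 2 * pi * (j%:R * x)) f); last exact: cf.
  by apply: cvgMr; apply: cvgMr.
move=> t; apply: cvgMr; apply: cvgD.
  by apply: (@continuous_comp _ _ _ _ (fun x : R => x ^+ 2)); [apply: cc; exact: continuous_cos|exact: exprn_continuous].
by apply: (@continuous_comp _ _ _ _ (fun x : R => x ^+ 2)); [apply: cc; exact: continuous_sin|exact: exprn_continuous].
Qed.

(** Multiplied by 2 sin (pi t), both sums telescope to two boundary values, hence have absolute
    value at most 2; each of the two squares then contributes 1 to the numerator. *)
Lemma fejer_le n t : (0 < n)%N -> sin (pi * t) != 0 ->
  fejer n t <= 2 / (n%:R * sin (pi * t) ^+ 2).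
Proof.
move=> n0 s0; set S := sin _ in s0 *.
have S0 : 0 < S ^+ 2 by rewrite exprn_even_gt0.
have hC m : 2 * S * (\sum_(j < m) cos (2 * pi * (j%:R * t))) =
    sin (2 * pi * (m%:R * t) - pi * t) + S.
  elim: m => [|m IH]; first by rewrite big_ord0 mulr0 mul0r mulr0 sub0r sinN addNr.
  rewrite big_ord_recr/= mulrDr IH.
  have -> : 2 * pi * (m.+1%:R * t) - pi * t = 2 * pi * (m%:R * t) + pi * t by rewrite -natr1; ring.
  by rewrite sinB sinD -/S; ring.
have hS m : 2 * S * (\sum_(j < m) sin (2 * pi * (j%:R * t))) =
    cos (pi * t) - cos (2 * pi * (m%:R * t) - pi * t).
  elim: m => [|m IH]; first by rewrite big_ord0 mulr0 mul0r mulr0 sub0r cosN subrr.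
  rewrite big_ord_recr/= mulrDr IH.
  have -> : 2 * pi * (m.+1%:R * t) - pi * t = 2 * pi * (m%:R * t) + pi * t by rewrite -natr1; ring.
  by rewrite cosB cosD -/S; ring.
have key (x : R) : `|2 * S * x| <= 2 -> S ^+ 2 * x ^+ 2 <= 1.
  rewrite -mulrA normrM ger0_norm// -ler_pdivlMl// mulVf// => h.
  by rewrite -exprMn -real_normK ?num_real// exprn_ile1.
have h1 := hC n; have h2 := hS n.
rewrite ler_pdivlMr; last by rewrite mulr_gt0 ?ltr0n.
rewrite /fejer mulrACA mulVf ?pnatr_eq0 -?lt0n// mul1r.
rewrite mulrC mulrDr -[2]/(1 + 1) lerD// key// ?h1 ?h2.
  by rewrite (le_trans (ler_normD _ _))// -[leRHS]/(1 + 1) lerD// sin_max.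
by rewrite (le_trans (ler_normB _ _))// -[leRHS]/(1 + 1) lerD// cos_max.
Qed.

End Fejer.

(** * Sums over infinite index sets *)

Section Esum.
Variable R : realType.

Lemma esumZl (J : choiceType) (c : R) (a : J -> R) : 0 <= c -> (forall y, 0 <= a y) ->
  (\esum_(y in [set: J]) (c * a y)%:E = c%:E * \esum_(y in [set: J]) (a y)%:E)%E.
Proof.
move=> c0 a0.
(* One inequality for all factors is enough: the reverse one is the case of c^-1 and the family c
   a. *)
have le (c' : R) (a' : J -> R) : 0 <= c' -> (forall y, 0 <= a' y) ->
    (\esum_(y in [set: J]) (c' * a' y)%:E <= c'%:E * \esum_(y in [set: J]) (a' y)%:E)%E.
  move=> c0' a0'; apply: ge_ereal_sup => _ [X [fX _] <-].
  rewrite fsbig_finite// sumEFin -mulr_sumr EFinM lee_wpmul2l ?lee_fin//.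
  by rewrite -sumEFin -fsbig_finite//; apply: ereal_sup_ubound; exists X.
apply/eqP; rewrite eq_le le//=; have [->|cn0] := eqVneq c 0.
  by rewrite mul0e esum_ge0// => y _; rewrite mul0r.
have {cn0}c0 : 0 < c by rewrite lt_neqAle eq_sym cn0.
rewrite muleC -lee_pdivlMr//.
have := le c^-1 (fun y => c * a y).
under eq_esum do rewrite mulKf ?gt_eqF//.
rewrite muleC => h; apply: h; first by rewrite invr_ge0 ltW.
by move=> y; rewrite mulr_ge0// ltW.
Qed.

(* Tannery's theorem along an arbitrary filter. *)
Lemma esum_dominated_cvg (J : choiceType) (I : Type) (F : set_system I) {FF : Filter F}
    (a : I -> J -> R) (a0 b : J -> R) :
  (forall i y, 0 <= a i y <= b y) -> (forall y, 0 <= a0 y <= b y) ->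
  (\esum_(y in [set: J]) (b y)%:E < +oo)%E ->
  (forall y, a i y @[i --> F] --> a0 y) ->
  fine (\esum_(y in [set: J]) (a i y)%:E) @[i --> F] --> fine (\esum_(y in [set: J]) (a0 y)%:E).
Proof.
move=> ab a0b bfin acvg; have b0 y : 0 <= b y by have /andP[/le_trans h /h] := a0b y.
apply/cvgrPdist_le => e e0; have e30 : 0 < e / 3 by rewrite divr_gt0.
have bfn : (\esum_(y in [set: J]) (b y)%:E)%E \is a fin_num.
  by rewrite ge0_fin_numE// esum_ge0// => y _; rewrite lee_fin.
(* The finite set X carries all but e / 3 of the sum of b. Off X both sums lie in [0, e / 3]; on X
   convergence is termwise. *)
have [_ [X [fX _] <-] hX] := ub_ereal_sup_adherent e30 bfn.
have split_esum (c : J -> R) : (forall y, 0 <= c y) ->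
    (\esum_(y in [set: J]) (c y)%:E =
     (\sum_(y <- finmap.enum_fset (fset_set X)) c y)%:E + \esum_(y in ~` X) (c y)%:E)%E.
  move=> c0; rewrite (esumID X)//; last by move=> y _; rewrite lee_fin.
  rewrite !setTI esum_fset//; last by move=> y _; rewrite lee_fin.
  by rewrite fsbig_finite// sumEFin.
have tailb : (\esum_(y in ~` X) (b y)%:E <= (e / 3)%:E)%E.
  have {hX} : (\esum_(y in [set: J]) (b y)%:E - (e / 3)%:E < \sum_(y \in X) (b y)%:E)%E := hX.
  move: bfn; rewrite split_esum// fsbig_finite// sumEFin.
  case: (\esum_(y in ~` X) (b y)%:E)%E => // r _.
  by rewrite lteBlDr// -!EFinD lte_fin lee_fin; lra.
have split_fine (c : J -> R) : (forall y, 0 <= c y <= b y) -> exists2 r : R, 0 <= r <= e / 3 &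
    fine (\esum_(y in [set: J]) (c y)%:E)%E = \sum_(y <- finmap.enum_fset (fset_set X)) c y + r.
  move=> cb; have c0 y : 0 <= c y by have /andP[] := cb y.
  have t1 : (\esum_(y in ~` X) (c y)%:E <= (e / 3)%:E)%E.
    apply: le_trans tailb; apply: le_esum => y _; rewrite lee_fin.
    by have /andP[] := cb y.
  have t0 : (0 <= \esum_(y in ~` X) (c y)%:E)%E by apply: esum_ge0 => y _; rewrite lee_fin.
  have tf : (\esum_(y in ~` X) (c y)%:E)%E \is a fin_num.
    by rewrite ge0_fin_numE// (le_lt_trans t1)// ltry.
  exists (fine (\esum_(y in ~` X) (c y)%:E)%E); last by rewrite split_esum// fineD.
  by rewrite fine_ge0//= -lee_fin fineK.
have : \sum_(y <- finmap.enum_fset (fset_set X)) a i y @[i --> F] --> \sum_(y <- finmap.enum_fset (fset_set X)) a0 y.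
  by apply: cvg_big => [|y _]; [exact: add_continuous|exact: acvg].
move=> /cvgrPdist_le/(_ _ e30); apply: filterS => i hi.
have [r r0 ->] := split_fine _ (ab i); have [r' r0' ->] := split_fine _ a0b.
rewrite opprD addrACA (le_trans (ler_normD _ _))//.
have -> : e = e / 3 + (e / 3 + e / 3) by field.
rewrite lerD//; apply: le_trans (_ : e / 3 <= _); last by rewrite lerDl ltW.
by rewrite ler_norml; lra.
Qed.

End Esum.

(** * Fejer kernels on the cells of the lattice Z / W *)

Section Cells.
Variable R : realType.
Implicit Types (W t : R) (n : nat) (y : int).
Notation mu := (@lebesgue_measure R).

(** Half-open so that the cells partition the line. Each is centred at the lattice point y / W and
    is one period of t -> [fejer n (W * t)]. *)
Definition cell W y : set R := `[(y%:~R - 2^-1) / W, (y%:~R + 2^-1) / W[.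

(** This enumeration turns a sum over [int] into a series, as countable additivity of the integral
    requires. *)
Definition int_of_nat n : int := if odd n then Negz n./2 else Posz n./2.

Lemma int_of_nat_bij : set_bij setT setT int_of_nat.
Proof.
rewrite setTT_bijective.
exists (fun z => match z with Posz k => k.*2 | Negz k => k.*2.+1 end).
  move=> n; rewrite /int_of_nat; case: ifP => on; rewrite -[RHS]odd_double_half on//.
by case=> k; rewrite /int_of_nat /= ?odd_double ?doubleK// uphalf_double.
Qed.

Lemma cellP W t y : 0 < W -> cell W y t <-> Num.floor (W * t + 2^-1) = y.
Proof.
move=> W0; rewrite /cell/= in_itv/= ler_pdivrMr// ltr_pdivlMr// [t * W]mulrC.
split => [h|<-].
  by apply: floor_def; rewrite intrD; lra.
by have := floor_itv (W * t + 2^-1); rewrite intrD => h; lra.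
Qed.

Lemma measurable_cell W y : measurable (cell W y).
Proof. exact: measurable_itv. Qed.

Lemma ge0_integral_cells W (f : R -> R) : 0 < W -> continuous f -> (forall t, 0 <= f t) ->
  (\int[mu]_t (f t)%:E = \esum_(y in [set: int]) \int[mu]_(t in cell W y) (f t)%:E)%E.
Proof.
move=> W0 cf f0.
have mf : measurable_fun setT (EFin \o f).
  by apply/measurable_EFinP; exact: continuous_measurable_fun.
rewrite (reindex_esum setT setT int_of_nat)/=; last exact: int_of_nat_bij.
rewrite -nneseries_esumT; last by move=> k; apply: integral_ge0 => t _; rewrite lee_fin.
have U : [set: R] = \bigcup_k cell W (int_of_nat k).
  apply/esym; rewrite -subTset => t _.
  have [_ _ /(_ (Num.floor (W * t + 2^-1)) I)[k _ hk]] := int_of_nat_bij.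
  by exists k => //; apply/cellP.
rewrite {1}U ge0_integral_bigcup//.
- by move=> k; exact: measurable_cell.
- by rewrite -U.
- by move=> t _; rewrite lee_fin.
- apply/trivIsetP => i j _ _ ij; rewrite -subset0 => t [/cellP-/(_ W0) hi /cellP-/(_ W0) hj].
  move/eqP: ij; apply; have [_ inj _] := int_of_nat_bij.
  by apply: inj; rewrite ?inE// -hi -hj.
Qed.

(** The double cosine sum has an explicit antiderivative. The n diagonal terms contribute 1 / W
    each; the others contribute nothing, because at both endpoints of the cell their sines are taken
    at integer multiples of pi. *)
Lemma integral_cell W n y : 0 < W -> (0 < n)%N ->
  (\int[mu]_(t in cell W y) (fejer n (W * t))%:E = (W^-1)%:E)%E.
Proof.
move=> W0 n0; rewrite /cell.
set a := _ / W; set b := _ / W.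
have ba : b - a = W^-1 by rewrite /a /b -mulrBl; set z := y%:~R; field; rewrite gt_eqF.
have ab : a < b by rewrite -subr_gt0 ba invr_gt0.
pose q (p t : R) := if p == 0 then t else sin (2 * pi * (p * (W * t))) / (2 * pi * p * W).
pose Q := fun t => n%:R^-1 * \sum_(j < n) \sum_(k < n) q (j%:R - k%:R) t.
have dQ (t : R) : is_derive t 1 (fun t => \sum_(j < n) \sum_(k < n) q (j%:R - k%:R) t)
    (\sum_(j < n) \sum_(k < n) cos (2 * pi * ((j%:R - k%:R) * (W * t)))).
  have -> : (fun t => \sum_(j < n) \sum_(k < n) q (j%:R - k%:R) t) =
      \sum_(j < n) \sum_(k < n) q (j%:R - k%:R).
    by apply/funext => u; rewrite fct_sumE; apply: eq_bigr => j _; rewrite fct_sumE.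
  apply: is_derive_sum => j; apply: is_derive_sum => k; set p := _ - _.
  rewrite /q; have [->|p0] := eqVneq p 0; first by rewrite mul0r mulr0 cos0; exact: is_derive_id.
  have c0 : 2 * pi * p * W != 0 by rewrite !mulf_neq0// ?gt_eqF// pi_gt0.
  have -> : (fun t0 => sin (2 * pi * (p * (W * t0))) / (2 * pi * p * W)) =
      (2 * pi * p * W)^-1 *: (sin \o (fun t0 => 2 * pi * p * W * t0)).
    by apply/funext => u; rewrite /= mulrC; congr (_ * sin _); ring.
  have -> : cos (2 * pi * (p * (W * t))) = (2 * pi * p * W)^-1 *: ((2 * pi * p * W) * cos (2 * pi * p * W * t)).
    by rewrite /GRing.scale/= mulKf//; congr cos; ring.
  apply: is_deriveZ; rewrite [X in is_derive _ _ _ X]mulrC.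
  apply: is_derive1_comp; rewrite -[X in is_derive _ _ _ X]mulr1; exact: is_deriveZ.
have cf : continuous (fun t => fejer n (W * t)).
  by move=> t; apply: (@continuous_comp _ _ _ (fun t => W * t)); [exact: mulrl_continuous|exact: fejer_continuous].
have dd (t : R) : is_derive t 1 Q (fejer n (W * t)).
  by rewrite fejerE; exact: (@is_deriveZ _ _ _ _ _ _ _ _ (dQ t)).
rewrite integral_itv_bndo_bndc; last first.
  apply/measurable_EFinP; apply: measurable_funTS; exact: continuous_measurable_fun cf.
have cQ : continuous Q.
  by move=> t; apply/differentiable_continuous/derivable1_diffP; exact: ex_derive.
rewrite (@continuous_FTC2 _ _ Q)//.
- rewrite -EFinB; congr EFin; rewrite /Q -mulrBr -sumrB.
  transitivity (n%:R^-1 * \sum_(j < n) W^-1).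
    congr (_ * _); apply: eq_bigr => j _; rewrite -sumrB (bigD1 j)//= big1 => [|k kj].
      by rewrite /q subrr eqxx addr0.
    rewrite /q subr_eq0 eqr_nat; case: eqVneq => [/val_inj jk|_]; first by rewrite jk eqxx in kj.
    rewrite -mulrBl (_ : _ - _ = 0) ?mul0r//.
    pose p := Posz j - Posz k.
    have pE : j%:R - k%:R = p%:~R :> R by rewrite /p intrB.
    have bE : 2 * pi * ((j%:R - k%:R) * (W * b)) = (p * (2 * y + 1))%:~R * pi.
      rewrite /b pE; have -> : W * ((y%:~R + 2^-1) / W) = y%:~R + 2^-1 by rewrite mulrCA divff ?mulr1// gt_eqF.
      by rewrite !(intrM, intrD); field.
    have aE : 2 * pi * ((j%:R - k%:R) * (W * a)) = (p * (2 * y - 1))%:~R * pi.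
      rewrite /a pE; have -> : W * ((y%:~R - 2^-1) / W) = y%:~R - 2^-1 by rewrite mulrCA divff ?mulr1// gt_eqF.
      by rewrite !(intrM, intrB); field.
    by rewrite aE bE !sin_int_pi subrr.
  by rewrite sumr_const card_ord -[X in _ * X]mulr_natl mulKf// pnatr_eq0 -lt0n.
- by apply: continuous_subspaceT.
- split; [by move=> t _; exact: ex_derive|exact/cvg_at_right_filter/cQ|exact/cvg_at_left_filter/cQ].
- by move=> t _; rewrite derive1E; exact: derive_val.
Qed.

Lemma continuous_fejer_scale W n : continuous (fun t => fejer n (W * t)).
Proof.
by move=> t; apply: (@continuous_comp _ _ _ (fun t => W * t));
  [exact: mulrl_continuous|exact: fejer_continuous].
Qed.

Lemma integrable_cell W y (f : R -> R) : continuous f -> mu.-integrable (cell W y) (EFin \o f).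
Proof.
move=> cf; apply: (@integrableS _ _ _ mu `[(y%:~R - 2^-1) / W, (y%:~R + 2^-1) / W]).
- exact: measurable_itv.
- exact: measurable_cell.
- by apply: subset_itv; rewrite bnd_simp.
- apply: continuous_compact_integrable; first exact: segment_compact.
  exact: continuous_subspaceT.
Qed.

Lemma Rintegral_cell W n y : 0 < W -> (0 < n)%N ->
  \int[mu]_(t in cell W y) fejer n (W * t) = W^-1.
Proof. by move=> W0 n0; rewrite /Rintegral integral_cell. Qed.

Lemma mu_cell W y : 0 < W -> fine (mu (cell W y)) = W^-1.
Proof.
move=> W0; have := Rintegral_cell y W0 (ltn0Sn 0).
under eq_Rintegral do rewrite fejer1.
by rewrite Rintegral_cst ?mul1r//; exact: measurable_cell.
Qed.

(** On the cell |y| <= W |t| + 1/2, so 1 + |y| <= (W + 3/2)(1 + |t|). *)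
Lemma pweight_cell (k : R) W y t : 0 <= k -> 0 < W -> cell W y t ->
  pweight k t <= (W + 3 / 2) `^ k * pweight k y%:~R.
Proof.
move=> k0 W0; rewrite /cell/= in_itv/= ler_pdivrMr// ltr_pdivlMr// => h.
have W3 : 0 < W + 3 / 2 by rewrite addr_gt0// divr_gt0.
have a0 : 0 < 1 + `|t| by rewrite ltr_pwDl.
have b0 : 0 < 1 + `|y%:~R : R| by rewrite ltr_pwDl.
have key : 1 + `|y%:~R : R| <= (W + 3 / 2) * (1 + `|t|).
  have h1 : `|y%:~R : R| <= `|t| * W + 2^-1.
    have -> : y%:~R = t * W + (y%:~R - t * W) by rewrite addrC subrK.
    rewrite (le_trans (ler_normD _ _))// normrM (gtr0_norm W0) lerD2l ler_norml; lra.
  have := normr_ge0 t; rewrite mulrDl !mulrDr !mulr1 [W * _]mulrC; lra.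
rewrite /pweight !powRN ler_pdivlMr ?powR_gt0// mulrC ler_pdivrMr ?powR_gt0//.
rewrite -powRM ?(ltW W3) ?(ltW a0)//.
by apply: ge0_ler_powR; rewrite ?nnegrE ?mulr_ge0 ?(ltW W3) ?(ltW a0) ?(ltW b0).
Qed.

(** The bound is uniform in n because the kernel has mass 1 / W on each cell for every n > 0, and
    vanishes for n = 0. It provides the dominating family for [esum_dominated_cvg]. *)
Lemma integral_cell_fejer_le (k C : R) W n y (h : R -> R) : 0 <= k -> 0 < W -> continuous h ->
  (forall t, 0 <= h t <= C * pweight k t) ->
  0 <= \int[mu]_(t in cell W y) (fejer n (W * t) * h t)
    <= C * (W + 3 / 2) `^ k / W * pweight k y%:~R.
Proof.
move=> k0 W0 ch hC.
have C0 : 0 <= C.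
  by have /andP[/le_trans/[apply]] := hC 0; rewrite pmulr_lge0 ?pweight_gt0.
have cfh : continuous (fun t => fejer n (W * t) * h t).
  by move=> t; apply: cvgM; [exact: continuous_fejer_scale|exact: ch].
apply/andP; split.
  by apply: Rintegral_ge0 => t _; rewrite mulr_ge0 ?fejer_ge0//; have /andP[] := hC t.
have B0 : 0 <= C * (W + 3 / 2) `^ k * pweight k y%:~R.
  by rewrite !mulr_ge0 ?powR_ge0 ?pweight_ge0.
have [->|n0] := posnP n.
  rewrite (_ : Rintegral _ _ _ = 0); last first.
    rewrite [LHS](_ : _ = \int[mu]_(t in cell W y) 0); last first.
      by apply: eq_Rintegral => t _; rewrite /fejer invr0 !mul0r.
    by rewrite Rintegral_cst ?mul0r//; exact: measurable_cell.
  by rewrite mulrAC mulr_ge0// invr_ge0 ltW.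
rewrite mulrAC -(Rintegral_cell y W0 n0) -RintegralZl; last 2 first.
- exact: measurable_cell.
- by apply: integrable_cell; exact: continuous_fejer_scale.
apply: le_Rintegral.
- exact: measurable_cell.
- exact: integrable_cell.
- by apply: integrable_cell => t; apply: cvgMr; exact: continuous_fejer_scale.
- move=> t ty; rewrite mulrC ler_wpM2r ?fejer_ge0//.
  have /andP[_ /le_trans->//] := hC t; rewrite -mulrA ler_wpM2l//.
  exact: pweight_cell.
Qed.

Lemma integrable_cell_sum (k C : R) W n (h : R -> R) : 1 < k -> 0 < W -> continuous h ->
  (forall t, 0 <= h t <= C * pweight k t) ->
  [/\ mu.-integrable setT (EFin \o (fun t => fejer n (W * t) * h t)),
    \int[mu]_t (fejer n (W * t) * h t) =
      fine (\esum_(y in [set: int]) (\int[mu]_(t in cell W y) (fejer n (W * t) * h t))%:E) &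
    \int[mu]_t (fejer n (W * t) * h t) <= C * ((W + 3 / 2) `^ k / W * (1 + 2 / (k - 1)))].
Proof.
move=> k1 W0 ch hC; have k0 : 0 <= k by lra.
have C0 : 0 <= C.
  by have /andP[/le_trans/[apply]] := hC 0; rewrite pmulr_lge0 ?pweight_gt0.
have cfh : continuous (fun t => fejer n (W * t) * h t).
  by move=> t; apply: cvgM; [exact: continuous_fejer_scale|exact: ch].
have f0 t : 0 <= fejer n (W * t) * h t.
  by rewrite mulr_ge0 ?fejer_ge0//; have /andP[] := hC t.
have E := ge0_integral_cells W0 cfh f0.
have E2 : (\int[mu]_t (fejer n (W * t) * h t)%:E =
    \esum_(y in [set: int]) (\int[mu]_(t in cell W y) (fejer n (W * t) * h t))%:E)%E.
  rewrite E; apply: eq_esum => y _; rewrite fineK//.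
  by apply: integrable_fin_num; [exact: measurable_cell|exact: integrable_cell].
have E3 : (\int[mu]_t (fejer n (W * t) * h t)%:E <=
    (C * ((W + 3 / 2) `^ k / W * (1 + 2 / (k - 1))))%:E)%E.
  rewrite E2; apply: (@le_trans _ _ (\esum_(y in [set: int])
      (C * (W + 3 / 2) `^ k / W * pweight k (1 * y%:~R))%:E)%E).
    apply: le_esum => y _; rewrite lee_fin mul1r.
    by have /andP[] := integral_cell_fejer_le n y k0 W0 ch hC.
  rewrite esumZl; last 2 first.
  - by rewrite !mulr_ge0 ?powR_ge0// invr_ge0 ltW.
  - by move=> y; exact: pweight_ge0.
  have := esum_pweight k1 (ltr01 : 0 < 1 :> R); rewrite mulr1 => h1.
  apply: le_trans (lee_wpmul2l _ h1) _.
    by rewrite lee_fin !mulr_ge0 ?powR_ge0// invr_ge0 ltW.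
  by rewrite -EFinM lee_fin !mulrA.
have I0 : (0 <= \int[mu]_t (fejer n (W * t) * h t)%:E)%E.
  by apply: integral_ge0 => t _; rewrite lee_fin.
split.
- apply/integrableP; split.
    by apply/measurable_EFinP; exact: continuous_measurable_fun.
  under eq_integral do rewrite /= ger0_norm//.
  by rewrite (le_lt_trans E3)// ltry.
- by rewrite /Rintegral E2.
- by rewrite -lee_fin /Rintegral fineK// ge0_fin_numE// (le_lt_trans E3)// ltry.
Qed.

(** Inside the cell the kernel concentrates at y / W only. It samples [h i] near that point while i
    moves, hence convergence jointly in i and t in place of pointwise convergence. *)
Lemma cvg_cell_fejer (k C : R) W y (I : Type) (F : set_system I) {FF : Filter F}
    (n : I -> nat) (h : I -> R -> R) (h0 : R -> R) : 0 <= k -> 0 < W ->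
  n i @[i --> F] --> \oo -> (forall i, continuous (h i)) ->
  (forall i t, 0 <= h i t <= C * pweight k t) -> (forall t, 0 <= h0 t <= C * pweight k t) ->
  (forall t, h p.1 p.2 @[p --> filter_prod F (nbhs t)] --> h0 t) ->
  \int[mu]_(t in cell W y) (fejer (n i) (W * t) * h i t) @[i --> F] --> W^-1 * h0 (W^-1 * y%:~R).
Proof.
move=> k0 W0 noo ch hC h0C hcvg; set t0 := W^-1 * y%:~R.
have C0 : 0 <= C.
  by have /andP[/le_trans/[apply]] := h0C 0; rewrite pmulr_lge0 ?pweight_gt0.
have pw1 t : C * pweight k t <= C.
  rewrite ler_piMr// /pweight powRN invf_le1 ?powR_gt0 ?ltr_pwDl//.
  apply: (@le_trans _ _ (1 `^ k)); first by rewrite powR1.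
  by apply: ge0_ler_powR; rewrite ?nnegrE ?addr_ge0// lerDl.
(* The error will be bounded by the integral over the cell of eta times the kernel plus eta, that is
   by 2 eta / W = e. *)
apply/cvgrPdist_le => e e0; pose eta := e * W / 2.
have eta0 : 0 < eta by rewrite /eta !mulr_gt0 ?invr_gt0.
have := hcvg t0 => /cvgrPdist_le/(_ _ eta0)[[A B]/= [FA [del/= del0 Bdel]] AB].
(* Distances are now measured in W t. The cap 1/2 keeps the arguments in [0, pi / 2], where sine
   increases, so that c bounds the squared sine from below at distance at least dl from the peak. *)
pose dl := Num.min (del * W) 2^-1.
have dl0 : 0 < dl by rewrite lt_min mulr_gt0//= invr_gt0.
have dl2 : dl <= 2^-1 by rewrite ge_min lexx orbT.
have pi0 := @pi_gt0 R.
have sdl : 0 < sin (pi * dl).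
  apply: sin_gt0_pi; rewrite mulr_gt0//= -[ltRHS]mulr1 ltr_pM2l//; lra.
set c := sin (pi * dl) ^+ 2; have c0 : 0 < c by rewrite exprn_gt0.
have far n' t : (0 < n')%N -> cell W y t -> dl <= `|W * t - y%:~R| ->
    fejer n' (W * t) <= 2 / (n'%:R * c).
  move=> n0; rewrite /cell/= in_itv/= ler_pdivrMr// ltr_pdivlMr// => ht hd.
  set s := W * t - y%:~R in hd; have hs : W * t = s + y%:~R by rewrite /s subrK.
  have s2 : `|s| <= 2^-1 by rewrite ler_norml /s [W * t]mulrC; lra.
  have sc : c <= sin (pi * (W * t)) ^+ 2.
    rewrite hs sin2_int_shift -[leRHS]real_normK ?num_real// ler_sqr ?nnegrE ?normr_ge0 ?(ltW sdl)//.
    have -> : `|sin (pi * s)| = `|sin (pi * `|s|)|.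
      by case: (ger0P s) => _ //; rewrite mulrN sinN normrN.
    apply: le_trans (ler_norm _).
    move: hd; rewrite le_eqVlt => /orP[/eqP<-//|hd].
    apply: ltW; rewrite ltr_sin ?in_itv/=; first by rewrite ltr_pM2l.
      have h1 : 0 <= pi * dl by rewrite mulr_ge0 ?ltW.
      have h2 : pi * dl <= pi * 2^-1 by rewrite ler_pM2l.
      by apply/andP; split; lra.
    have h1 : 0 <= pi * `|s| by rewrite mulr_ge0 ?(ltW pi0).
    have h2 : pi * `|s| <= pi * 2^-1 by rewrite ler_pM2l.
    by apply/andP; split; lra.
  have s0 : sin (pi * (W * t)) != 0.
    by rewrite -sqrf_eq0 gt_eqF// (lt_le_trans c0).
  apply: le_trans (fejer_le n0 s0) _.
  have nR : 0 < n'%:R :> R by rewrite ltr0n.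
  apply: ler_wpM2l => //; rewrite lef_pV2 ?posrE; last 2 first.
  - by rewrite mulr_gt0// (lt_le_trans c0).
  - by rewrite mulr_gt0.
  by rewrite ler_pM2l.
(* From this index on, the far contribution 2 C / (n c) is at most eta. *)
pose N0 := (Num.truncn (4 * C / (c * e * W))).+1.
have FN : F [set i | (N0 <= n i)%N] by exact: (noo [set m | (N0 <= m)%N] (nbhs_infty_ge N0)).
near=> i.
have nN : (N0 <= n i)%N by near: i.
have Ai : A i by near: i.
have n0 : (0 < n i)%N by apply: leq_trans nN.
have D : C * (2 / ((n i)%:R * c)) <= eta.
  have : 4 * C / (c * e * W) <= (n i)%:R.
    apply: ltW; apply: lt_le_trans (truncnS_gt _) _; by rewrite ler_nat.
  rewrite ler_pdivrMr ?mulr_gt0// => hn.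
  have -> : C * (2 / ((n i)%:R * c)) = 2 * C / ((n i)%:R * c) by ring.
  rewrite ler_pdivrMr ?mulr_gt0 ?ltr0n// /eta.
  have -> : e * W / 2 * ((n i)%:R * c) = (n i)%:R * (c * e * W) / 2 by ring.
  lra.
have cF : continuous (fun t => fejer (n i) (W * t)) by exact: continuous_fejer_scale.
have cfh : continuous (fun t => fejer (n i) (W * t) * h i t).
  by move=> t; apply: cvgM; [exact: cF|exact: ch].
have mc := measurable_cell W y.
rewrite -(Rintegral_cell y W0 n0) -RintegralZr//; last exact: integrable_cell.
rewrite -RintegralB//; last 2 first.
- by apply: integrable_cell => t; apply: cvgMl; exact: cF.
- exact: integrable_cell.
have cd : continuous (fun t => fejer (n i) (W * t) * h0 t0 - fejer (n i) (W * t) * h i t).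
  by move=> t; apply: cvgB; [apply: cvgMl; exact: cF|exact: cfh].
apply: le_trans.
  by apply: le_normr_Rintegral => //; exact: integrable_cell.
apply: (@le_trans _ _ (\int[mu]_(t in cell W y) (eta * fejer (n i) (W * t) + eta))).
  apply: le_Rintegral => //.
  - by apply: integrable_cell => t; apply: cvg_norm; exact: cd.
  - apply: integrable_cell => t; apply: cvgD; last exact: cvg_cst.
    by apply: cvgMr; exact: cF.
  move=> t ty; rewrite -mulrBr normrM (ger0_norm (fejer_ge0 _ _)).
  have [near_|far_] := ltP `|W * t - y%:~R| dl.
    rewrite mulrC; apply: le_trans (_ : eta * fejer (n i) (W * t) <= _); last by rewrite lerDl ltW.
    rewrite ler_wpM2r ?fejer_ge0//; apply: (AB (i, t)); split => //=; apply: Bdel => /=.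
    have -> : t0 - t = - (W^-1 * (W * t - y%:~R)) by rewrite mulrBr mulKf ?gt_eqF// opprB.
    rewrite normrN normrM (gtr0_norm (_ : 0 < W^-1)) ?invr_gt0// mulrC ltr_pdivrMr//.
    by apply: lt_le_trans near_ _; rewrite ge_min lexx.
  apply: le_trans (_ : eta <= _); last by rewrite lerDr mulr_ge0 ?fejer_ge0// ltW.
  apply: le_trans D; rewrite mulrC; apply: ler_pM => //; first exact: fejer_ge0; last exact: far.
  have := hC i t; have := h0C t0; have := pw1 t; have := pw1 t0 => a1 a2 a3 a4.
  rewrite ler_norml; lra.
rewrite RintegralD//; last 2 first.
- by apply: integrable_cell => t; apply: cvgMr; exact: cF.
- by apply: integrable_cell => t; exact: cvg_cst.
rewrite RintegralZl//; last exact: integrable_cell.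
rewrite Rintegral_cell// Rintegral_cst// mu_cell//.
rewrite -mulrDl /eta le_eqVlt; apply/orP; left; apply/eqP; field; by rewrite gt_eqF.
Unshelve. all: by end_near. Qed.

(* The measures fejer n (W t) dt converge to W^-1 times the counting measure of
   the lattice Z / W, tested against functions converging continuously. *)
Lemma cvg_integral_fejer (k C : R) W (I : Type) (F : set_system I) {FF : Filter F}
    (n : I -> nat) (h : I -> R -> R) (h0 : R -> R) : 1 < k -> 0 < W ->
  n i @[i --> F] --> \oo -> (forall i, continuous (h i)) ->
  (forall i t, 0 <= h i t <= C * pweight k t) -> (forall t, 0 <= h0 t <= C * pweight k t) ->
  (forall t, h p.1 p.2 @[p --> filter_prod F (nbhs t)] --> h0 t) ->
  \int[mu]_t (fejer (n i) (W * t) * h i t) @[i --> F] -->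
    W^-1 * fine (\esum_(y in [set: int]) (h0 (W^-1 * y%:~R))%:E).
Proof.
move=> k1 W0 noo ch hC h0C hcvg; have k0 : 0 <= k by lra.
have C0 : 0 <= C.
  by have /andP[/le_trans/[apply]] := h0C 0; rewrite pmulr_lge0 ?pweight_gt0.
have -> : (fun i => \int[mu]_t (fejer (n i) (W * t) * h i t)) = fun i =>
    fine (\esum_(y in [set: int]) (\int[mu]_(t in cell W y) (fejer (n i) (W * t) * h i t))%:E).
  by apply/funext => i; have [_ -> _] := integrable_cell_sum (n i) k1 W0 (ch i) (hC i).
have Wi0 : 0 <= W^-1 by rewrite invr_ge0 ltW.
have -> : W^-1 * fine (\esum_(y in [set: int]) (h0 (W^-1 * y%:~R))%:E) =
    fine (\esum_(y in [set: int]) (W^-1 * h0 (W^-1 * y%:~R))%:E).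
  rewrite esumZl//; last by move=> y; have /andP[] := h0C (W^-1 * y%:~R).
  rewrite fineM// ge0_fin_numE; last by apply: esum_ge0 => y _; rewrite lee_fin; have /andP[] := h0C (W^-1 * y%:~R).
  apply: (@le_lt_trans _ _ (\esum_(y in [set: int]) (C * pweight k (W^-1 * y%:~R))%:E)%E).
    by apply: le_esum => y _; rewrite lee_fin; have /andP[] := h0C (W^-1 * y%:~R).
  rewrite esumZl//; last by move=> y; exact: pweight_ge0.
  have := esum_pweight k1 (_ : 0 < W^-1); rewrite invr_gt0 => /(_ W0) hs.
  by rewrite (le_lt_trans (lee_wpmul2l _ hs)) ?lee_fin// -EFinM ltry.
(* The maximum dominates both the cell integrals and their limits. *)
apply: (@esum_dominated_cvg _ _ _ _ _ _ _
  (fun y => Num.max (C * (W + 3 / 2) `^ k / W * pweight k y%:~R) (W^-1 * C * pweight k (W^-1 * y%:~R)))).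
- move=> i y; have /andP[-> h2] /= := integral_cell_fejer_le (n i) y k0 W0 (ch i) (hC i).
  by rewrite le_max h2.
- move=> y; have /andP[h1 h2] := h0C (W^-1 * y%:~R).
  by rewrite mulr_ge0//= le_max -[W^-1 * C * _]mulrA ler_wpM2l ?orbT.
- apply: (@le_lt_trans _ _ (\esum_(y in [set: int]) ((C * (W + 3 / 2) `^ k / W * pweight k (1 * y%:~R))%:E + (W^-1 * C * pweight k (W^-1 * y%:~R))%:E))%E).
    apply: le_esum => y _; rewrite -EFinD lee_fin mul1r ge_max.
    by rewrite lerDl lerDr !mulr_ge0 ?pweight_ge0 ?powR_ge0.
  rewrite esumD; try by move=> y _; rewrite lee_fin !mulr_ge0 ?pweight_ge0 ?powR_ge0.
  have hs := esum_pweight k1 (ltr01 : 0 < 1 :> R).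
  have := esum_pweight k1 (_ : 0 < W^-1); rewrite invr_gt0 => /(_ W0) hs'.
  rewrite !esumZl ?mulr_ge0 ?powR_ge0//; try by move=> y; exact: pweight_ge0.
  apply: (le_lt_trans (leeD (lee_wpmul2l _ hs) (lee_wpmul2l _ hs'))); rewrite ?lee_fin ?mulr_ge0 ?powR_ge0//.
  by rewrite -!EFinM -EFinD ltry.
- by move=> y; apply: cvg_cell_fejer k0 W0 noo ch hC h0C hcvg.
Qed.

End Cells.

(** * Iterated integrals of dominated functions *)

Section VectorCons.
Variable R : realType.

(** Written exactly as in the recursion of [iint], so that unfolding an iterated integral produces
    slices along [vcons] by conversion. *)
Definition vcons (T : Type) d (t : T) (v : 'rV[T]_d) : 'rV[T]_d.+1 :=
  row_mx (const_mx t : 'rV_1) v.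

Lemma vcons0 (T : Type) d (t : T) (v : 'rV[T]_d) : vcons t v 0 ord0 = t.
Proof. by rewrite /vcons mxE; case: splitP => j //= _; rewrite mxE. Qed.

Lemma vconsS (T : Type) d (t : T) (v : 'rV[T]_d) i : vcons t v 0 (lift ord0 i) = v 0 i.
Proof.
rewrite /vcons mxE; case: splitP => j /= e; first by have := ltn_ord j; rewrite -e.
by congr (v _ _); apply: val_inj; move: e => [].
Qed.

Lemma vconsP (T : Type) d (t : T) (v : 'rV[T]_d) (P : 'I_d.+1 -> T -> Prop) :
  P ord0 t -> (forall i, P (lift ord0 i) (v 0 i)) -> forall i, P i (vcons t v 0 i).
Proof.
move=> h0 hS i; case: (unliftP ord0 i) => [j|] ->; first by rewrite vconsS.
by rewrite vcons0.
Qed.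

Lemma vcons_surj (T : Type) d (u : 'rV[T]_d.+1) : exists t v, u = vcons t v.
Proof.
exists (u 0 ord0), (\row_i u 0 (lift ord0 i)); apply/rowP => i; apply/esym.
by apply: (@vconsP _ _ _ _ (fun i x => x = u 0 i)) => // j; rewrite mxE.
Qed.

Lemma vcons_inj (T : Type) d (t t' : T) (v v' : 'rV[T]_d) :
  vcons t v = vcons t' v' -> t = t' /\ v = v'.
Proof.
move=> e; split; first by rewrite -(vcons0 t v) e vcons0.
by apply/rowP => i; rewrite -(vconsS t) e vconsS.
Qed.

Lemma cvg_mx_entries (T : Type) (F : set_system T) {FF : Filter F} m n
    (f : T -> 'M[R]_(m, n)) (l : 'M[R]_(m, n)) :
  (forall i j, f x i j @[x --> F] --> l i j) -> f x @[x --> F] --> l.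
Proof.
move=> h; apply/cvg_ballP => e e0.
have : \forall x \near F, forall ij : 'I_m * 'I_n, ball (l ij.1 ij.2) e (f x ij.1 ij.2).
  by apply: filter_forall => -[i j]; have /cvg_ballP := h i j; apply.
by apply: filterS => x hx; split => // i j; exact: (hx (i, j)).
Qed.

Lemma cvg_vcons (T : Type) (F : set_system T) {FF : Filter F} d
    (a : T -> R) (b : T -> 'rV[R]_d) (t : R) (v : 'rV[R]_d) :
  a x @[x --> F] --> t -> b x @[x --> F] --> v -> vcons (a x) (b x) @[x --> F] --> vcons t v.
Proof.
move=> at_ bv; apply: cvg_mx_entries => i j; rewrite (ord1 i).
case: (unliftP ord0 j) => [j'|] ->.
  rewrite vconsS; under eq_fun do rewrite vconsS.
  by apply: (@cvg_comp _ _ _ _ (fun M : 'rV[R]_d => M 0 j') _ _ _ bv); exact: coord_continuous.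
by rewrite vcons0; under eq_fun do rewrite vcons0.
Qed.

Lemma esum_vcons d (a : 'rV[int]_d.+1 -> \bar R) : (forall m, (0 <= a m)%E) ->
  (\esum_(m in [set: 'rV[int]_d.+1]) a m =
   \esum_(y in [set: int]) \esum_(m in [set: 'rV[int]_d]) a (vcons y m))%E.
Proof.
move=> a0; rewrite (@esum_esum _ _ _ _ (fun=> setT) (fun y m => a (vcons y m)))//.
rewrite (reindex_esum ([set: int] `*`` (fun=> [set: 'rV[int]_d])) setT (fun p => vcons p.1 p.2))//.
split => //.
- by move=> [y m] [y' m'] _ _ /= h; have [-> ->] := vcons_inj h.
- by move=> u _; have [t [v ->]] := vcons_surj u; exists (t, v).
Qed.

End VectorCons.

Section IteratedIntegral.
Variables (R : realType) (k : R).
Hypothesis k1 : 1 < k.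
Notation mu := (@lebesgue_measure R).
Local Notation w := (pweight k).

Let k0 : 0 <= k. Proof. by move: k1; lra. Qed.

Definition prodw d (u : 'rV[R]_d) : R := \prod_(i < d) w (u 0 i).

(** The class is closed under taking slices: the product weight factors, and the slice at t has the
    constant C w(t), which is integrable in t. Continuity takes care of measurability. *)
Definition dominated d (C : R) (g : 'rV[R]_d -> R) :=
  continuous g /\ forall u, `|g u| <= C * prodw u.

Lemma pweight_le1 t : w t <= 1.
Proof.
rewrite /pweight powRN invf_le1 ?powR_gt0 ?ltr_pwDl//.
apply: (@le_trans _ _ (1 `^ k)); first by rewrite powR1.
by apply: ge0_ler_powR; rewrite ?nnegrE ?addr_ge0// lerDl.
Qed.

Lemma prodw_gt0 d (u : 'rV[R]_d) : 0 < prodw u.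
Proof. by apply: prodr_gt0 => i _; exact: pweight_gt0. Qed.

Lemma prodw_vcons d t (v : 'rV[R]_d) : prodw (vcons t v) = w t * prodw v.
Proof.
rewrite /prodw big_ord_recl vcons0; congr *%R.
by apply: eq_bigr => i _; rewrite vconsS.
Qed.

Lemma dominated_ge0 d C (g : 'rV[R]_d -> R) : dominated C g -> 0 <= C.
Proof.
by move=> [_ /(_ 0)/(le_trans (normr_ge0 _))]; rewrite pmulr_lge0 ?prodw_gt0.
Qed.

Lemma dominated_slice d C (g : 'rV[R]_d.+1 -> R) t : dominated C g ->
  dominated (C * w t) (fun v => g (vcons t v)).
Proof.
move=> [cg gC]; split => [v|v]; last by rewrite -mulrA -prodw_vcons.
apply: (@continuous_comp _ _ _ (fun v => vcons t v) g); last exact: cg.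
by apply: (@cvg_vcons _ _ (nbhs v) _ _ (fun=> t) id t v); [exact: cvg_cst|exact: cvg_id].
Qed.

(** Forgetting the factor w(t) gives one constant for all slices, as convergence along a sequence of
    slices requires. *)
Lemma dominated_slice_le d C (g : 'rV[R]_d.+1 -> R) t : dominated C g ->
  dominated C (fun v => g (vcons t v)).
Proof.
move=> dg; have [cg gC] := dominated_slice t dg; split => // v.
apply: le_trans (gC v) _; rewrite ler_wpM2r ?(ltW (prodw_gt0 _))//.
by rewrite ler_piMr ?(dominated_ge0 dg)// pweight_le1.
Qed.

Definition intw : R := \int[mu]_t w t.

(** This is the cell decomposition for W = 1 and n = 1, the kernel [fejer 1] being constantly 1. *)
Lemma integrable_pweight : mu.-integrable setT (EFin \o w).
Proof.
have h t : 0 <= w t <= 1 * w t by rewrite mul1r pweight_ge0/=.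
have [+ _ _] := integrable_cell_sum 1 k1 ltr01 (@pweight_continuous _ k) h.
by congr (_.-integrable _ _); apply/funext => t; rewrite /= fejer1 mul1r.
Qed.

(** Dominated convergence is about sequences; this turns it into continuity of slice integrals. *)
Lemma continuous_seq (h : R -> R) :
  (forall (u : nat -> R) t, u n @[n --> \oo] --> t -> h (u n) @[n --> \oo] --> h t) -> continuous h.
Proof. by move=> hu t; apply/(@cvg_nbhsP _ R^o) => u ut; exact: hu. Qed.

Lemma integrable_le_pweight C (h : R -> R) : continuous h -> (forall t, `|h t| <= C * w t) ->
  mu.-integrable setT (EFin \o h).
Proof.
move=> ch hC; apply: (@le_integrable _ _ _ mu setT _ _ (EFin \o (fun t => C * w t))) => //.
- by apply/measurable_EFinP; exact: continuous_measurable_fun.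
- move=> t _; rewrite /= lee_fin; apply: le_trans (hC t) _; exact: ler_norm.
- have := integrableZl measurableT C integrable_pweight.
  by congr (_.-integrable _ _).
Qed.

(** The two claims are proved in one induction: in dimension d + 1 both need integrable slice
    integrals, which takes continuity (the convergence claim in dimension d) and decay (the bound in
    dimension d). *)
Lemma iint_bound_cvg d :
  (forall C (g : 'rV[R]_d -> R), dominated C g -> `|iint g| <= C * intw ^+ d) /\
  (forall C (g_ : nat -> 'rV[R]_d -> R) g, (forall n, dominated C (g_ n)) -> dominated C g ->
    (forall u, g_ n u @[n --> \oo] --> g u) -> iint (g_ n) @[n --> \oo] --> iint g).
Proof.
elim: d => [|d [IHb IHc]].
  split => [C g [_ /(_ 0)]|C g_ g _ _ /(_ 0) //]; by rewrite /prodw big_ord0 expr0.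
have slice_cont C (g : 'rV[R]_d.+1 -> R) : dominated C g ->
    continuous (fun t => iint (fun v => g (vcons t v))).
  move=> dg; apply: continuous_seq => u t ut.
  apply: (IHc C) => [n||v]; [exact: dominated_slice_le|exact: dominated_slice_le|].
  have [cg _] := dg; apply: (@cvg_comp _ _ _ (fun n => vcons (u n) v) g _ _ _ _ (cg (vcons t v))).
  by apply: cvg_vcons => //; exact: cvg_cst.
have slice_bound C (g : 'rV[R]_d.+1 -> R) t : dominated C g ->
    `|iint (fun v => g (vcons t v))| <= C * intw ^+ d * w t.
  by move=> dg; rewrite mulrAC; apply: IHb; exact: dominated_slice.
have slice_int C (g : 'rV[R]_d.+1 -> R) : dominated C g ->
    mu.-integrable setT (EFin \o (fun t => iint (fun v => g (vcons t v)))).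
  move=> dg; apply: (@integrable_le_pweight (C * intw ^+ d)); first exact: slice_cont dg.
  by move=> t; exact: slice_bound.
have intc C : mu.-integrable setT (EFin \o (fun t => C * w t)).
  by have := integrableZl measurableT C integrable_pweight; congr (_.-integrable _ _).
split => [C g dg|C g_ g dg_ dg gg].
  apply: le_trans (le_normr_Rintegral measurableT (slice_int C g dg)) _.
  rewrite exprSr mulrA -RintegralZl//; last exact: integrable_pweight.
  apply: le_Rintegral => //; last by move=> t _; exact: slice_bound.
  have /integrable_abse := slice_int C g dg.
  by congr (_.-integrable _ _).
have [] := @dominated_convergence _ _ _ mu setT measurableT
  (fun n t => (iint (fun v => g_ n (vcons t v)))%:E) (fun t => (iint (fun v => g (vcons t v)))%:E)
  (EFin \o (fun t => C * intw ^+ d * w t)).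
- by move=> n; have /integrableP[] := slice_int C (g_ n) (dg_ n).
- by have /integrableP[] := slice_int C g dg.
- apply: aeW => t _; apply: cvg_EFin; first exact: nearW.
  apply: (IHc C) => [n||v]; [exact: dominated_slice_le|exact: dominated_slice_le|exact: gg].
- exact: intc.
- by apply: aeW => t n _; rewrite /= lee_fin; exact: slice_bound.
move=> _ _ h; apply: fine_cvg; rewrite fineK; last exact: integrable_fin_num (slice_int C g dg).
exact: h.
Qed.

Lemma iint_cvg d C (g_ : nat -> 'rV[R]_d -> R) g : (forall n, dominated C (g_ n)) -> dominated C g ->
  (forall u, g_ n u @[n --> \oo] --> g u) -> iint (g_ n) @[n --> \oo] --> iint g.
Proof. by have [_] := iint_bound_cvg d; apply. Qed.

Lemma iint_norm_le d C (g : 'rV[R]_d -> R) : dominated C g -> `|iint g| <= C * intw ^+ d.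
Proof. by have [+ _] := iint_bound_cvg d; apply. Qed.

Lemma iint_slice_continuous d C (g : 'rV[R]_d.+1 -> R) : dominated C g ->
  continuous (fun t => iint (fun v => g (vcons t v))).
Proof.
move=> dg; apply: continuous_seq => u t ut.
apply: (@iint_cvg _ C) => [n||v]; [exact: dominated_slice_le|exact: dominated_slice_le|].
have [cg _] := dg; apply: (@cvg_comp _ _ _ (fun n => vcons (u n) v) g _ _ _ _ (cg (vcons t v))).
by apply: cvg_vcons => //; exact: cvg_cst.
Qed.

Lemma iint_slice_integrable d C (g : 'rV[R]_d.+1 -> R) : dominated C g ->
  mu.-integrable setT (EFin \o (fun t => iint (fun v => g (vcons t v)))).
Proof.
move=> dg; apply: (@integrable_le_pweight (C * intw ^+ d)); first exact: iint_slice_continuous dg.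
by move=> t; rewrite mulrAC; apply: iint_norm_le; exact: dominated_slice.
Qed.

Lemma dominated_lin d a C C' (g h : 'rV[R]_d -> R) : dominated C g -> dominated C' h ->
  dominated (`|a| * C + C') (fun u => a * g u + h u).
Proof.
move=> [cg gC] [ch hC]; split => [u|u].
  have ca : continuous (fun u => a * g u).
    by move=> x; apply: continuousM; [exact: cst_continuous|exact: cg].
  exact: (cvgD (ca u) (ch u)).
by rewrite (le_trans (ler_normD _ _))// mulrDl lerD// normrM -mulrA ler_wpM2l.
Qed.

Lemma dominated0 d : @dominated d 0 (fun=> 0).
Proof. by split => [u|u]; [exact: cst_continuous|rewrite normr0 mul0r]. Qed.

Lemma dominated_mul d (C B : R) (g b : 'rV[R]_d -> R) : dominated C g -> continuous b ->
  (forall u, `|b u| <= B) -> dominated (C * B) (fun u => g u * b u).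
Proof.
move=> [cg gC] cb bB; split => [u|u]; first by apply: continuousM; [exact: cg|exact: cb].
by rewrite normrM mulrAC ler_pM.
Qed.

Lemma iint_lin d a C C' (g h : 'rV[R]_d -> R) : dominated C g -> dominated C' h ->
  iint (fun u => a * g u + h u) = a * iint g + iint h.
Proof.
elim: d C C' g h => [//|d IH] C C' g h dg dh /=.
have ig := iint_slice_integrable dg; have ih := iint_slice_integrable dh.
rewrite -(RintegralZl a measurableT ig) -RintegralD//; last first.
  by have := integrableZl measurableT a ig; congr (_.-integrable _ _).
apply: eq_Rintegral => t _.
by rewrite (IH _ _ _ _ (dominated_slice t dg) (dominated_slice t dh)).
Qed.

Lemma iint0 d : @iint R d (fun=> 0) = 0.
Proof.
by elim: d => [//|d IH] /=; rewrite IH Rintegral_cst// mul0r.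
Qed.

Lemma iintZ d a C (g : 'rV[R]_d -> R) : dominated C g -> iint (fun u => a * g u) = a * iint g.
Proof.
move=> dg; have := iint_lin a dg (@dominated0 d); rewrite iint0 addr0 => <-.
by congr iint; apply/funext => u; rewrite addr0.
Qed.

Lemma dominated_sum d (J : Type) (r : seq J) (g : J -> 'rV[R]_d -> R) :
  (forall j, exists C, dominated C (g j)) ->
  exists C, dominated C (fun u => \sum_(j <- r) g j u).
Proof.
move=> dg; elim: r => [|j r [C dC]].
  exists 0; rewrite (_ : (fun u => _) = (fun=> 0)); first exact: dominated0.
  by apply/funext => u; rewrite big_nil.
have [C' dj] := dg j; exists (`|1| * C' + C).
rewrite (_ : (fun u => _) = (fun u => 1 * g j u + \sum_(j <- r) g j u)).
  exact: dominated_lin.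
by apply/funext => u; rewrite big_cons mul1r.
Qed.

Lemma iint_sum d (J : Type) (r : seq J) (g : J -> 'rV[R]_d -> R) :
  (forall j, exists C, dominated C (g j)) ->
  iint (fun u => \sum_(j <- r) g j u) = \sum_(j <- r) iint (g j).
Proof.
move=> dg; elim: r => [|j r IH].
  rewrite big_nil (_ : (fun u => _) = (fun=> 0)) ?iint0//.
  by apply/funext => u; rewrite big_nil.
have [C dC] := dominated_sum r dg; have [C' dj] := dg j.
rewrite big_cons -IH -[X in X + _]mul1r -(iint_lin _ dj dC).
by congr iint; apply/funext => u; rewrite big_cons mul1r.
Qed.

Lemma iint_ge0 d (g : 'rV[R]_d -> R) : (forall u, 0 <= g u) -> 0 <= iint g.
Proof.
elim: d g => [g g0|d IH g g0] /=; first exact: g0.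
by apply: Rintegral_ge0 => t _; exact: IH.
Qed.

End IteratedIntegral.

(** * Fejer means and lattice sums *)

Section FejerIntegral.
Variables (R : realType) (k W : R).
Hypotheses (k1 : 1 < k) (W0 : 0 < W).
Notation mu := (@lebesgue_measure R).
Local Notation w := (pweight k).
Local Notation prodk := (prodw k).
Local Notation domk := (dominated k).

Definition fejern n d (u : 'rV[R]_d) : R := \prod_(i < d) fejer n (W * u 0 i).

Lemma fejern_vcons n d t (v : 'rV[R]_d) : fejern n (vcons t v) = fejer n (W * t) * fejern n v.
Proof.
rewrite /fejern big_ord_recl vcons0; congr *%R.
by apply: eq_bigr => i _; rewrite vconsS.
Qed.

Lemma fejern_ge0 n d (u : 'rV[R]_d) : 0 <= fejern n u.
Proof. by apply: prodr_ge0 => i _; exact: fejer_ge0. Qed.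

(** A crude bound, enough to keep g times the kernel dominated for each fixed n; estimates uniform
    in n come from the cells. *)
Lemma fejer_le_double n (t : R) : fejer n t <= 2 * n%:R.
Proof.
have key (f : R -> R) : (forall x, -1 <= f x <= 1) ->
    (\sum_(j < n) f (2 * pi * (j%:R * t))) ^+ 2 <= n%:R ^+ 2.
  move=> hf; rewrite -[leLHS]real_normK ?num_real// ler_sqr ?nnegrE//.
  apply: le_trans (ler_norm_sum _ _ _) _; rewrite -[n in leRHS]card_ord -sumr_const.
  by apply: ler_sum => j _; rewrite ler_norml.
have [->|n0] := posnP n; first by rewrite /fejer invr0 mul0r mulr0.
have nR : 0 < n%:R :> R by rewrite ltr0n.
rewrite /fejer mulrC ler_pdivrMr// -mulrA -expr2.
have -> : 2 * n%:R ^+ 2 = n%:R ^+ 2 + n%:R ^+ 2 :> R by ring.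
by apply: lerD; apply: key => x; rewrite ?cos_geN1 ?cos_le1 ?sin_geN1 ?sin_le1.
Qed.

Lemma fejern_continuous n d : continuous (fun u : 'rV[R]_d => fejern n u).
Proof.
rewrite /fejern; apply: continuous_big => [|i _ u]; first exact: mul_continuous.
apply: (@continuous_comp _ _ _ (fun u : 'rV[R]_d => u 0 i) (fun t => fejer n (W * t))).
  exact: coord_continuous.
exact: continuous_fejer_scale.
Qed.

Lemma dominated_fejern n d C (g : 'rV[R]_d -> R) : domk C g ->
  domk (C * (2 * n%:R) ^+ d) (fun u => g u * fejern n u).
Proof.
move=> dg; apply: dominated_mul => // [|u]; first exact: fejern_continuous.
rewrite ger0_norm ?fejern_ge0// /fejern -[d in leRHS]card_ord -prodr_const.
by apply: ler_prod => i _; rewrite fejer_ge0 fejer_le_double.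
Qed.

Definition fejer_int n d (g : 'rV[R]_d -> R) : R := iint (fun u => g u * fejern n u).

Lemma fejer_intS n d C (g : 'rV[R]_d.+1 -> R) : domk C g ->
  fejer_int n g = \int[mu]_t (fejer n (W * t) * fejer_int n (fun v => g (vcons t v))).
Proof.
move=> dg; rewrite /fejer_int /=; apply: eq_Rintegral => t _.
rewrite -(iintZ k1 _ (dominated_fejern n (dominated_slice t dg))).
by congr iint; apply/funext => v; rewrite -/(vcons t v) fejern_vcons mulrCA.
Qed.

Lemma fejer_int_slice_continuous n d C (g : 'rV[R]_d.+1 -> R) : domk C g ->
  continuous (fun t => fejer_int n (fun v => g (vcons t v))).
Proof.
(* The kernel in the first coordinate is left out, since it stands outside the slice integral. *)
move=> dg; pose g' (u : 'rV[R]_d.+1) := g u * \prod_(i < d) fejer n (W * u 0 (lift ord0 i)).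
have dg' : domk (C * (2 * n%:R) ^+ d) g'.
  apply: dominated_mul => // [|u].
    apply: continuous_big => [|i _ u]; first exact: mul_continuous.
    apply: (@continuous_comp _ _ _ (fun u : 'rV[R]_d.+1 => u 0 (lift ord0 i)) (fun t => fejer n (W * t))).
      exact: coord_continuous.
    exact: continuous_fejer_scale.
  rewrite ger0_norm; last by apply: prodr_ge0 => i _; exact: fejer_ge0.
  rewrite -[d in leRHS]card_ord -prodr_const.
  by apply: ler_prod => i _; rewrite fejer_ge0 fejer_le_double.
rewrite (_ : (fun t => _) = (fun t => iint (fun v => g' (vcons t v)))).
  exact: (iint_slice_continuous k1 dg').
apply/funext => t; congr iint; apply/funext => v; congr *%R.
by apply: eq_bigr => i _; rewrite vconsS.
Qed.

(** The bound from [integrable_cell_sum] for the integral of the one-dimensional kernel against w,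
    uniform in n. *)
Let kappa := (W + 3 / 2) `^ k / W * (1 + 2 / (k - 1)).

Let kappa_ge0 : 0 <= kappa.
Proof. by rewrite /kappa !mulr_ge0 ?powR_ge0 ?invr_ge0 ?addr_ge0 ?mulr_ge0 ?invr_ge0 ?subr_ge0 ?ltW. Qed.

Lemma fejer_int_bound n d C (g : 'rV[R]_d -> R) : domk C g -> (forall u, 0 <= g u) ->
  0 <= fejer_int n g <= C * kappa ^+ d.
Proof.
move=> dg g0; apply/andP; split.
  by apply: iint_ge0 => u; rewrite mulr_ge0// fejern_ge0.
elim: d C g dg g0 => [|d IH] C g dg g0.
  rewrite /fejer_int /fejern /= big_ord0 mulr1 expr0; have [_ /(_ 0)] := dg.
  by rewrite /prodw big_ord0 ger0_norm.
rewrite (fejer_intS n dg) exprSr mulrA.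
have [] := @integrable_cell_sum _ k (C * kappa ^+ d) W n (fun t => fejer_int n (fun v => g (vcons t v)))
  k1 W0 (fejer_int_slice_continuous dg); last by move=> _ _.
move=> t; rewrite iint_ge0/=; last by move=> u; rewrite mulr_ge0// fejern_ge0.
by rewrite mulrAC; apply: IH => //; exact: dominated_slice.
Qed.

Definition zpoint d (m : 'rV[int]_d) : 'rV[R]_d := \row_i (W^-1 * (m 0 i)%:~R).

Lemma zpoint_vcons d y (m : 'rV[int]_d) : zpoint (vcons y m) = vcons (W^-1 * y%:~R) (zpoint m).
Proof.
apply/rowP => j; rewrite mxE; case: (unliftP ord0 j) => [j'|] ->; last by rewrite !vcons0.
by rewrite !vconsS mxE.
Qed.

(** The bound from [esum_pweight] for the sum of w over Z / W. *)
Let Z := 1 + 2 / ((k - 1) * W^-1).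

Let Z_ge0 : 0 <= Z.
Proof. by rewrite /Z addr_ge0 ?mulr_ge0 ?invr_ge0 ?mulr_ge0 ?subr_ge0 ?invr_ge0 ?ltW. Qed.

Lemma esum_prodw d : (\esum_(m in [set: 'rV[int]_d]) (prodk (zpoint m))%:E <= (Z ^+ d)%:E)%E.
Proof.
elim: d => [|d IH].
  rewrite (_ : [set: 'rV[int]_0] = [set 0]); last first.
    by apply/seteqP; split => m //= _; apply/rowP => -[].
  by rewrite esum_set1 ?lee_fin ?(ltW (prodw_gt0 _ _))// /prodw big_ord0 expr0.
rewrite esum_vcons; last by move=> m; rewrite lee_fin ltW// prodw_gt0.
have h y : (\esum_(m in [set: 'rV[int]_d]) (prodk (zpoint (vcons y m)))%:E =
    (w (W^-1 * y%:~R))%:E * \esum_(m in [set: 'rV[int]_d]) (prodk (zpoint m))%:E)%E.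
  rewrite -esumZl ?pweight_ge0//; last by move=> m; rewrite ltW// prodw_gt0.
  by apply: eq_esum => m _; rewrite zpoint_vcons prodw_vcons.
under eq_esum do rewrite h.
apply: (@le_trans _ _ (\esum_(y in [set: int]) (Z ^+ d * w (W^-1 * y%:~R))%:E)%E).
  apply: le_esum => y _; rewrite [Z ^+ d * _]mulrC EFinM lee_wpmul2l// lee_fin; exact: pweight_ge0.
rewrite esumZl ?exprn_ge0//; last by move=> y; exact: pweight_ge0.
rewrite exprSr EFinM lee_wpmul2l ?lee_fin ?exprn_ge0//.
by apply: esum_pweight => //; rewrite invr_gt0.
Qed.

Lemma esum_dominated d C (g : 'rV[R]_d -> R) : domk C g -> (forall u, 0 <= g u) ->
  (0 <= \esum_(m in [set: 'rV[int]_d]) (g (zpoint m))%:E <= (C * Z ^+ d)%:E)%E.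
Proof.
move=> dg g0; rewrite esum_ge0/=; last by move=> m _; rewrite lee_fin.
apply: (@le_trans _ _ (\esum_(m in [set: 'rV[int]_d]) (C * prodk (zpoint m))%:E)%E).
  apply: le_esum => m _; rewrite lee_fin; have [_ /(_ (zpoint m))] := dg.
  by rewrite ger0_norm.
have C0 := dominated_ge0 dg.
rewrite esumZl//; last by move=> m; rewrite ltW// prodw_gt0.
rewrite EFinM lee_wpmul2l ?lee_fin//; exact: esum_prodw.
Qed.

Definition lattice_sum d (g : 'rV[R]_d -> R) : R := zsum (fun m => g (zpoint m)).

Lemma lattice_sum_bound d C (g : 'rV[R]_d -> R) : domk C g -> (forall u, 0 <= g u) ->
  0 <= lattice_sum g <= C * Z ^+ d.
Proof.
move=> dg g0; have /andP[h0 h1] := esum_dominated dg g0.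
rewrite /lattice_sum /zsum fine_ge0//= -lee_fin fineK// ge0_fin_numE//.
by rewrite (le_lt_trans h1)// ltry.
Qed.

Lemma lattice_sumS d C (g : 'rV[R]_d.+1 -> R) : domk C g -> (forall u, 0 <= g u) ->
  lattice_sum g =
  fine (\esum_(y in [set: int]) (lattice_sum (fun v => g (vcons (W^-1 * y%:~R) v)))%:E).
Proof.
move=> dg g0; rewrite /lattice_sum /zsum esum_vcons; last by move=> m; rewrite lee_fin.
congr fine; apply: eq_esum => y _; rewrite fineK; last first.
  have /andP[h0 h1] := esum_dominated (dominated_slice (W^-1 * y%:~R) dg) (fun v => g0 _).
  by rewrite ge0_fin_numE// (le_lt_trans h1)// ltry.
by apply: eq_esum => m _; rewrite zpoint_vcons.
Qed.

(* By induction on the dimension; the first coordinate joins the index set, so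
   that continuous convergence passes to the slices. *)
Lemma cvg_fejer_int d (I : Type) (F : set_system I) {FF : Filter F} C
    (n : I -> nat) (g : I -> 'rV[R]_d -> R) (g0 : 'rV[R]_d -> R) :
  n i @[i --> F] --> \oo -> (forall i, domk C (g i)) -> domk C g0 ->
  (forall i u, 0 <= g i u) -> (forall u, 0 <= g0 u) ->
  (forall u : 'rV[R]_d, g p.1 p.2 @[p --> filter_prod F (nbhs u)] --> g0 u) ->
  fejer_int (n i) (g i) @[i --> F] --> W^-1 ^+ d * lattice_sum g0.
Proof.
elim: d I F FF C n g g0 => [|d IH] I F FF C n g g0 noo dg dg0 g_ge0 g0_ge0 gcvg.
  have -> : W^-1 ^+ 0 * lattice_sum g0 = g0 0.
    rewrite expr0 mul1r /lattice_sum /zsum (_ : [set: 'rV[int]_0] = [set 0]); last first.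
      by apply/seteqP; split => m //= _; apply/rowP => -[].
    by rewrite esum_set1 ?lee_fin//=; congr g0; apply/rowP => -[].
  have -> : (fun i => fejer_int (n i) (g i)) = (fun i => g i 0).
    by apply/funext => i; rewrite /fejer_int /fejern/= big_ord0 mulr1.
  apply: (@cvg_comp _ _ _ (fun i => (i, 0 : 'rV[R]_0)) (fun p => g p.1 p.2) _ _ _ _ (gcvg 0)).
  move=> P [[A B]/= [FA nB] AB]; apply: filterS FA => i Ai.
  by apply: (AB (i, 0)); split => //; exact: nbhs_singleton.
have -> : (fun i => fejer_int (n i) (g i)) = fun i =>
    \int[mu]_t (fejer (n i) (W * t) * fejer_int (n i) (fun v => g i (vcons t v))).
  by apply/funext => i; exact: fejer_intS (dg i).
rewrite (lattice_sumS dg0 g0_ge0) exprS -mulrA.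
pose h0 t := W^-1 ^+ d * lattice_sum (fun v => g0 (vcons t v)).
have Wd : 0 <= W^-1 ^+ d by rewrite exprn_ge0// invr_ge0 ltW.
have C0 := dominated_ge0 dg0.
have -> : W^-1 ^+ d * fine (\esum_(y in [set: int]) (lattice_sum (fun v => g0 (vcons (W^-1 * y%:~R) v)))%:E) =
    fine (\esum_(y in [set: int]) (h0 (W^-1 * y%:~R))%:E).
  rewrite esumZl//; last first.
    by move=> y; have /andP[] := lattice_sum_bound (dominated_slice (W^-1 * y%:~R) dg0) (fun v => g0_ge0 _).
  rewrite fineM// ge0_fin_numE; last first.
    by apply: esum_ge0 => y _; rewrite lee_fin; have /andP[] := lattice_sum_bound (dominated_slice (W^-1 * y%:~R) dg0) (fun v => g0_ge0 _).
  apply: (@le_lt_trans _ _ (\esum_(y in [set: int]) (C * Z ^+ d * w (W^-1 * y%:~R))%:E)%E).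
    apply: le_esum => y _; rewrite lee_fin mulrAC.
    by have /andP[] := lattice_sum_bound (dominated_slice (W^-1 * y%:~R) dg0) (fun v => g0_ge0 _).
  rewrite esumZl ?mulr_ge0 ?exprn_ge0//; last by move=> y; exact: pweight_ge0.
  have Wi : 0 < W^-1 by rewrite invr_gt0.
  by rewrite (le_lt_trans (lee_wpmul2l _ (esum_pweight k1 Wi))) ?lee_fin ?mulr_ge0 ?exprn_ge0// -EFinM ltry.
(* One summand bounds the slice integrals, the other their limits. *)
apply: (@cvg_integral_fejer _ k (C * (kappa ^+ d + (W^-1 * Z) ^+ d))) => //.
- by move=> i; exact: fejer_int_slice_continuous (dg i).
- move=> i t; have /andP[-> h] /= := fejer_int_bound (n i) (dominated_slice t (dg i)) (fun v => g_ge0 i _).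
  apply: le_trans h _; rewrite mulrAC ler_wpM2r ?pweight_ge0//.
  by rewrite ler_wpM2l// lerDl exprn_ge0// mulr_ge0 ?invr_ge0 ?(ltW W0).
- move=> t; have /andP[h0' h] := lattice_sum_bound (dominated_slice t dg0) (fun v => g0_ge0 _).
  rewrite /h0 mulr_ge0//=; apply: le_trans (ler_wpM2l Wd h) _.
  rewrite (_ : W^-1 ^+ d * _ = C * (W^-1 * Z) ^+ d * w t); last by rewrite exprMn; ring.
  rewrite ler_wpM2r ?pweight_ge0// ler_wpM2l// lerDr exprn_ge0//.
- move=> t; apply: (IH (I * R)%type (filter_prod F (nbhs t)) _ C (fun p => n p.1)
    (fun p v => g p.1 (vcons p.2 v)) (fun v => g0 (vcons t v))) => //.
  + by apply: cvg_comp noo; exact: cvg_fst.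
  + by move=> p; exact: dominated_slice_le.
  + exact: dominated_slice_le.
  move=> v; apply: (@cvg_comp _ _ _ (fun q : (I * R) * 'rV[R]_d => (q.1.1, vcons q.1.2 q.2))
    (fun p => g p.1 p.2) _ _ _ _ (gcvg (vcons t v))).
  set G := filter_prod _ (nbhs v).
  have vG : vcons q.1.2 q.2 @[q --> G] --> vcons t v.
    apply: cvg_vcons; last exact: cvg_snd.
    exact: (@cvg_comp _ _ _ fst snd _ _ _ cvg_fst cvg_snd).
  move=> P [[A B]/= [FA nB] AB].
  have GA : G (fun q => A q.1.1).
    exact: (@cvg_comp _ _ _ fst fst G (filter_prod F (nbhs t)) F cvg_fst cvg_fst A FA).
  by apply: filterS (filterI GA (vG B nB)) => q [? ?]; exact: (AB (_, _)).
Qed.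

End FejerIntegral.

Local Open Scope complex_scope.

(** * Poisson summation *)

Section ComplexExponential.
Variable R : realType.
Implicit Types (x y t : R) (n : nat).

Definition cexp x : R[i] := cos x +i* sin x.

Lemma cexpD x y : cexp (x + y) = cexp x * cexp y.
Proof.
apply/eqP; rewrite eq_complex /= cosD sinD eqxx/=; apply/eqP.
by rewrite addrC.
Qed.

Lemma cexp0 : cexp 0 = 1.
Proof. by rewrite /cexp cos0 sin0. Qed.

Lemma cexp_sum (J : Type) (r : seq J) (f : J -> R) :
  cexp (\sum_(j <- r) f j) = \prod_(j <- r) cexp (f j).
Proof. exact: (big_morph cexp cexpD cexp0). Qed.

Lemma norm_cexp x : `|cexp x| = 1.
Proof. by rewrite normc_def /= cos2Dsin2 sqrtr1. Qed.

Lemma sum_complex (J : Type) (r : seq J) (f g : J -> R) :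
  \sum_(j <- r) (f j +i* g j) = (\sum_(j <- r) f j) +i* (\sum_(j <- r) g j).
Proof.
elim: r => [|j r IH]; first by rewrite !big_nil.
by rewrite !big_cons IH.
Qed.

(** The kernel is an exponential sum times its conjugate. Pairs of indices are kept, not collected
    by their difference, so that the product over coordinates expands into a plain sum over
    functions. *)
Lemma fejer_cexp n t : (fejer n t)%:C =
  (n%:R^-1)%:C * \sum_(p : 'I_n * 'I_n) cexp (2 * pi * (((p.1 : nat)%:R - (p.2 : nat)%:R) * t)).
Proof.
rewrite -(pair_bigA _ (fun j k : 'I_n => cexp (2 * pi * ((j%:R - k%:R) * t))))/=.
have -> : \sum_(j < n) \sum_(k < n) cexp (2 * pi * ((j%:R - k%:R) * t)) =
    (\sum_(j < n) cexp (2 * pi * (j%:R * t))) * (\sum_(k < n) cexp (- (2 * pi * (k%:R * t)))).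
  rewrite big_distrlr/=; apply: eq_bigr => j _; apply: eq_bigr => k _.
  by rewrite -cexpD mulrBl mulrBr.
have -> : \sum_(k < n) cexp (- (2 * pi * (k%:R * t))) =
    (\sum_(k < n) cos (2 * pi * (k%:R * t))) +i* (- \sum_(k < n) sin (2 * pi * (k%:R * t))).
  rewrite /cexp sum_complex -sumrN; congr (_ +i* _); apply: eq_bigr => k _.
    by rewrite cosN.
  by rewrite sinN.
rewrite /cexp sum_complex /fejer.
set a := \sum_(_ < _) _; set b := \sum_(_ < _) _.
by apply/eqP; rewrite eq_complex /=; apply/andP; split; apply/eqP; ring.
Qed.

(** The number of P with frequency m, divided by n^d, is the Cesaro weight, the product of the 1 -
    |m_i| / n when all |m_i| < n. *)
Definition freq n d (P : {ffun 'I_d -> 'I_n * 'I_n}) : 'rV[int]_d :=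
  \row_i (((P i).1 : nat)%:Z - ((P i).2 : nat)%:Z).

Lemma cos_mul_fejern W n d (u : 'rV[R]_d) x :
  cos x * fejern W n u = n%:R^-1 ^+ d *
    \sum_(P : {ffun 'I_d -> 'I_n * 'I_n}) cos (2 * pi * (W * \sum_i (freq P 0 i)%:~R * u 0 i) + x).
Proof.
have : cexp x * (fejern W n u)%:C = (n%:R^-1 ^+ d)%:C *
    \sum_(P : {ffun 'I_d -> 'I_n * 'I_n}) cexp (2 * pi * (W * \sum_i (freq P 0 i)%:~R * u 0 i) + x).
  rewrite /fejern rmorph_prod/=; under eq_bigr do rewrite fejer_cexp.
  rewrite big_split/= prodr_const card_ord bigA_distr_bigA/= rmorphXn/= mulrCA; congr (_ * _).
  rewrite mulr_sumr; apply: eq_bigr => P _; rewrite cexpD mulrC -cexp_sum; congr (cexp _ * _).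
  rewrite !mulr_sumr.
  by apply: eq_bigr => i _; rewrite mxE intrB; ring.
move=> /(congr1 (@complex.Re R)) /=; rewrite mulr0 subr0 => ->.
by rewrite /cexp sum_complex /= mul0r subr0.
Qed.

End ComplexExponential.

Section Poisson.
Variables (R : realType) (k W : R).
Hypotheses (k1 : 1 < k) (W0 : 0 < W).
Local Notation domk := (dominated k).

(* The phase treats both parts of the Fourier transform at once: theta = 0 gives
   the real part and theta = - pi / 2 the opposite of the imaginary part. *)
Definition fourier_cos d (f : 'rV[R]_d -> R) (theta : R) (z : 'rV[R]_d) : R :=
  iint (fun u => f u * cos (2 * pi * dotp z u + theta)).

Lemma dotp_continuous d (z : 'rV[R]_d) : continuous (fun u => dotp z u).
Proof.
apply: continuous_big => [|i _ u]; first exact: add_continuous.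
by apply: continuousM; [exact: cst_continuous|exact: coord_continuous].
Qed.

Lemma dominated_cos d C (f : 'rV[R]_d -> R) theta z : domk C f ->
  domk C (fun u => f u * cos (2 * pi * dotp z u + theta)).
Proof.
move=> df; rewrite -[C]mulr1; apply: dominated_mul => // u.
  apply: (@continuous_comp _ _ _ (fun u => dotp z u) (fun x : R => cos (2 * pi * x + theta))).
    exact: dotp_continuous.
  apply: (@continuous_comp _ _ _ (fun x : R => 2 * pi * x + theta) cos); last exact: continuous_cos.
  by apply: cvgD; [exact: mulrl_continuous|exact: cvg_cst].
by rewrite ler_norml cos_geN1 cos_le1.
Qed.

(** The addition formula for cosine gives a combination of real and imaginary parts with
    coefficients cos theta and sin theta; bounding each part by the modulus costs the factor 2. *)
Lemma norm_fourier_cos d C (f : 'rV[R]_d -> R) theta z : domk C f ->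
  `|fourier_cos f theta z| <= 2 * fourier_abs f z.
Proof.
move=> df.
have dc : domk C (fun u => f u * cos (2 * pi * dotp z u)).
  have := dominated_cos 0 z df; congr (dominated _ _ _).
  by apply/funext => u; rewrite addr0.
have ds : domk C (fun u => f u * sin (2 * pi * dotp z u)).
  have := dominated_cos (- (pi / 2)) z df; congr (dominated _ _ _).
  by apply/funext => u; rewrite cosBpihalf.
have -> : fourier_cos f theta z = cos theta * fourier_re f z + sin theta * fourier_im f z.
  rewrite /fourier_re /fourier_im mulrN -mulNr -(iintZ k1 (- sin theta) ds).
  have := dominated_lin (- sin theta) ds (dominated0 k d); rewrite addr0.
  under eq_fun do rewrite addr0.
  move=> ds'; rewrite -(iint_lin k1 (cos theta) dc ds'); congr iint; apply/funext => u.
  by rewrite cosD; ring.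
have re : `|fourier_re f z| <= fourier_abs f z.
  by rewrite /fourier_abs -sqrtr_sqr ler_sqrt ?lerDl ?addr_ge0 ?sqr_ge0.
have im : `|fourier_im f z| <= fourier_abs f z.
  by rewrite /fourier_abs -sqrtr_sqr ler_sqrt ?lerDr ?addr_ge0 ?sqr_ge0.
rewrite (le_trans (ler_normD _ _))// mulr_natl mulr2n !normrM lerD//.
  by apply: le_trans re; rewrite ler_piMl// ler_norml cos_geN1 cos_le1.
by apply: le_trans im; rewrite ler_piMl// ler_norml sin_geN1 sin_le1.
Qed.

Lemma fejer_int_cos n d C (f : 'rV[R]_d -> R) theta z : domk C f ->
  fejer_int W n (fun u => f u * cos (2 * pi * dotp z u + theta)) =
  n%:R^-1 ^+ d * \sum_(P : {ffun 'I_d -> 'I_n * 'I_n})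
    fourier_cos f theta (z + W *: map_mx intr (freq P)).
Proof.
move=> df; rewrite /fejer_int.
have dP (P : {ffun 'I_d -> 'I_n * 'I_n}) : exists C', domk C'
    (fun u => f u * cos (2 * pi * dotp (z + W *: map_mx intr (freq P)) u + theta)).
  by exists C; exact: dominated_cos.
rewrite -(iint_sum k1 _ dP).
have [C' dS] : exists C', domk C' (fun u => \sum_(P : {ffun 'I_d -> 'I_n * 'I_n})
    f u * cos (2 * pi * dotp (z + W *: map_mx intr (freq P)) u + theta)).
  by exact: dominated_sum.
rewrite -(iintZ k1 _ dS); congr iint; apply/funext => u.
rewrite -mulr_sumr mulrCA -mulrA cos_mul_fejern; congr (f u * (_ * _)).
apply: eq_bigr => P _; congr cos; rewrite addrC -addrA [theta + _]addrC addrA; congr (_ + _).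
rewrite -mulrDr; congr (_ * _); rewrite addrC /dotp mulr_sumr -big_split/=.
by apply: eq_bigr => i _; rewrite !mxE; ring.
Qed.

(** Frequency zero means a diagonal pair in every coordinate, so its weight in the Fejer mean is
    exactly 1. *)
Lemma card_freq0 n d : #|[pred P : {ffun 'I_d -> 'I_n * 'I_n} | freq P == 0]| = (n ^ d)%N.
Proof.
pose dg (q : {ffun 'I_d -> 'I_n}) : {ffun 'I_d -> 'I_n * 'I_n} := [ffun i => (q i, q i)].
have dgi : injective dg.
  by move=> q q' /ffunP h; apply/ffunP => i; have := h i; rewrite !ffunE => -[].
have -> : (n ^ d)%N = #|{ffun 'I_d -> 'I_n}| by rewrite card_ffun !card_ord.
rewrite -(card_codom dgi); apply: eq_card => P; rewrite !inE; apply/eqP/codomP.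
  move=> /rowP h; exists [ffun i => (P i).1]; apply/ffunP => i; rewrite !ffunE.
  have := h i; rewrite !mxE => /eqP; rewrite subr_eq0 => /eqP [] /val_inj e.
  by rewrite [P i]surjective_pairing/= e.
by move=> [q ->]; apply/rowP => i; rewrite !mxE ffunE subrr.
Qed.

(* The lattice sum of f cos is written as a difference of two sums because [zsum]
   is meaningful for nonnegative functions only. *)
Lemma poisson_bound d C (f : 'rV[R]_d -> R) theta z B : domk C f -> (forall u, 0 <= f u) ->
  (forall n, (0 < n)%N -> n%:R^-1 ^+ d * \sum_(P : {ffun 'I_d -> 'I_n * 'I_n} | freq P != 0)
     `|fourier_cos f theta (z + W *: map_mx intr (freq P))| <= B) ->
  `|W^-1 ^+ d * (lattice_sum W (fun u => f u * (1 + cos (2 * pi * dotp z u + theta))) - lattice_sum W f)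
    - fourier_cos f theta z| <= B.
Proof.
move=> df f0 hB.
pose g u := f u * (1 + cos (2 * pi * dotp z u + theta)).
have gE u : g u = 1 * (f u * cos (2 * pi * dotp z u + theta)) + f u by rewrite /g; ring.
have dcos := dominated_cos theta z df.
have dg : domk (`|1| * C + C) g.
  by have := dominated_lin 1 dcos df; congr (dominated _ _ _); apply/funext => u; rewrite gE.
have g0 u : 0 <= g u by rewrite mulr_ge0// -lerBlDl sub0r cos_geN1.
have const_cvg (h : 'rV[R]_d -> R) : continuous h -> forall u : 'rV[R]_d,
    h p.2 @[p --> filter_prod (\oo : set_system nat) (nbhs u)] --> h u.
  move=> ch u; apply: (@cvg_comp _ _ _ snd h); [exact: cvg_snd|exact: ch].
have idoo : n @[n --> (\oo : set_system nat)] --> (\oo : set_system nat) by exact: cvg_id.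
have [cg _] := dg; have [cf _] := df.
have lim1 := @cvg_fejer_int R k W k1 W0 d nat \oo eventually_filter _ id (fun=> g) g idoo (fun=> dg) dg (fun=> g0) g0 (const_cvg g cg).
have lim2 := @cvg_fejer_int R k W k1 W0 d nat \oo eventually_filter _ id (fun=> f) f idoo (fun=> df) df (fun=> f0) f0 (const_cvg f cf).
have lim3 : `|fejer_int W n g - fejer_int W n f - fourier_cos f theta z| @[n --> \oo] -->
    `|W^-1 ^+ d * (lattice_sum W g - lattice_sum W f) - fourier_cos f theta z|.
  rewrite mulrBr; apply: cvg_norm; apply: cvgB; last exact: cvg_cst.
  by apply: cvgB; [exact: lim1|exact: lim2].
apply: (cvgr_to_le lim3); near=> n.
have n0 : (0 < n)%N by near: n; exact: nbhs_infty_gt.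
have -> : fejer_int W n g - fejer_int W n f =
    fejer_int W n (fun u => f u * cos (2 * pi * dotp z u + theta)).
  apply/eqP; rewrite subr_eq; apply/eqP; rewrite /fejer_int -[X in _ = X + _]mul1r.
  rewrite -(iint_lin k1 1 (dominated_fejern W n dcos) (dominated_fejern W n df)).
  by congr iint; apply/funext => u; rewrite gE; ring.
(* The terms of frequency zero add up to [fourier_cos f theta z] and cancel; the others are the
   hypothesis on B. *)
rewrite (fejer_int_cos n theta z df) (bigID (fun P => freq P == 0))/=.
rewrite (eq_bigr (fun=> fourier_cos f theta z)); last first.
  by move=> P /eqP ->; congr fourier_cos; apply/rowP => i; rewrite !mxE mulr0 addr0.
rewrite sumr_const card_freq0 mulrDr -[X in n%:R^-1 ^+ d * X]mulr_natl natrX mulrA -exprMn mulVf ?pnatr_eq0 -?lt0n//.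
rewrite expr1n mul1r addrAC subrr add0r.
apply: le_trans (hB n n0); rewrite normrM ger0_norm ?exprn_ge0 ?invr_ge0//.
by rewrite ler_wpM2l ?exprn_ge0 ?invr_ge0// ler_norm_sum.
Unshelve. all: by end_near. Qed.

End Poisson.

(** * Fourier analysis on the discrete torus *)

Lemma euclid_unique (L a b : nat) (x A B : int) : (a < L)%N -> (b < L)%N ->
  x - a%:Z + L%:Z * A = x - b%:Z + L%:Z * B -> A = B /\ a = b.
Proof.
move=> aL bL h.
have mul_lt (A' B' : int) : A' < B' -> L%:Z * A' + L%:Z <= L%:Z * B'.
  by rewrite -lezD1 => AB; rewrite -[X in _ + X]mulr1 -mulrDr ler_wpM2l.
have AB : A = B.
  have [//|] := eqVneq A B; rewrite neq_lt => /orP[] /mul_lt hl; exfalso.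
    by move: hl h; move: (L%:Z * A) (L%:Z * B) => u v; lia.
  by move: hl h; move: (L%:Z * A) (L%:Z * B) => u v; lia.
by split => //; move: h; rewrite AB => /addIr; lia.
Qed.

Section FiniteFourier.
Variables (R : realType) (d L : nat).
Hypothesis L0 : (0 < L)%N.
Local Notation Lam := (Lam d L).

Definition latvec (x : Lam) : 'rV[int]_d := \row_i (x i : nat)%:Z.

Definition chi (k : Lam) (v : 'rV[int]_d) : R[i] :=
  cexp (2 * pi * (L%:R^-1 * \sum_i (k i : nat)%:R * (v 0 i)%:~R)).

Lemma cexp_int (z : int) : cexp (2 * pi * z%:~R) = 1 :> R[i].
Proof.
have -> : 2 * pi * z%:~R = z%:~R * pi + z%:~R * pi :> R by ring.
by rewrite /cexp cosD sinD !sin_int_pi !mulr0 mul0r addr0 subr0 -expr2 cos_int_pi.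
Qed.

Lemma chiD k v v' : chi k (v + v') = chi k v * chi k v'.
Proof.
rewrite /chi -cexpD; congr cexp; rewrite -mulrDr -mulrDr; congr (_ * (_ * _)).
by rewrite -big_split/=; apply: eq_bigr => i _; rewrite mxE intrD mulrDr.
Qed.

Lemma chi_zero k : chi k 0 = 1.
Proof.
rewrite /chi big1 ?mulr0 ?cexp0// => i _; by rewrite mxE mulr0.
Qed.

Lemma chi_period k m : chi k (L%:Z *: m) = 1.
Proof.
rewrite /chi; pose z : int := \sum_i (k i : nat)%:Z * m 0 i.
rewrite -[RHS](cexp_int z); congr (cexp (_ * _)).
rewrite /z rmorph_sum/= mulr_sumr; apply: eq_bigr => i _.
rewrite mxE !intrM -[L%:Z%:~R]/(L%:R) -[(k i : nat)%:Z%:~R]/((k i : nat)%:R).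
by field; rewrite pnatr_eq0 -lt0n.
Qed.

Lemma norm_chi k v : `|chi k v| = 1.
Proof. exact: norm_cexp. Qed.

Lemma cexp_neq1 (t : R) : 0 < t < 1 -> cexp (2 * pi * t) != 1.
Proof.
move=> /andP[t0 t1]; apply/negP => /eqP /(congr1 (@complex.Re R)) /= h.
have s0 : 0 < sin (pi * t).
  by apply: sin_gt0_pi; rewrite mulr_gt0 ?pi_gt0//= -[ltRHS]mulr1 ltr_pM2l ?pi_gt0.
move: h; have -> : 2 * pi * t = pi * t + pi * t by ring.
rewrite cosD -!expr2 => h; have := cos2Dsin2 (pi * t).
have : 0 < sin (pi * t) ^+ 2 by rewrite exprn_gt0.
lra.
Qed.

Lemma sum_cexp (z : int) : (`|z| < L)%N ->
  \sum_(j < L) cexp (2 * pi * (L%:R^-1 * (j%:R * z%:~R))) = if z == 0 then L%:R else 0 :> R[i].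
Proof.
move=> zL; case: eqP => [->|/eqP z0].
  under eq_bigr do rewrite !mulr0 cexp0.
  by rewrite sumr_const card_ord.
have LR : 0 < L%:R :> R by rewrite ltr0n.
set q := cexp (2 * pi * (L%:R^-1 * z%:~R)) : R[i].
have qj (j : nat) : cexp (2 * pi * (L%:R^-1 * (j%:R * z%:~R))) = q ^+ j.
  elim: j => [|j IH]; first by rewrite mul0r !mulr0 cexp0.
  rewrite exprS -IH /q -cexpD; congr cexp; rewrite -natr1; ring.
under eq_bigr do rewrite qj.
have qL : q ^+ L = 1.
  by rewrite -qj -[RHS](cexp_int z) mulKf ?gt_eqF.
have q1 : q != 1.
  (* [cexp_neq1] wants an argument in (0, 1); for z < 0 it is applied to -z, whose exponential is
     the inverse of q. *)
  case: (ltrgtP z 0) z0 => // hz _.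
    have : cexp (2 * pi * (L%:R^-1 * (- z)%:~R)) != 1 :> R[i].
      apply: cexp_neq1; rewrite mulr_gt0 ?invr_gt0 ?ltr0z ?oppr_gt0//=.
      rewrite mulrC ltr_pdivrMr// mul1r -[L%:R]/(L%:Z%:~R) ltr_int; lia.
    apply: contraNN => /eqP q1; rewrite -q1 /q.
    have : q * cexp (2 * pi * (L%:R^-1 * (- z)%:~R)) = 1.
      by rewrite /q -cexpD intrN mulrN mulrN subrr cexp0.
    by rewrite q1 mul1r => ->; rewrite -/q q1.
  apply: cexp_neq1; rewrite mulr_gt0 ?invr_gt0 ?ltr0z//=.
  rewrite mulrC ltr_pdivrMr// mul1r -[L%:R]/(L%:Z%:~R) ltr_int; lia.
have := subrX1 q L; rewrite qL subrr => /esym/eqP.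
by rewrite mulf_eq0 subr_eq0 (negbTE q1) => /eqP.
Qed.

Lemma chi_orthogonality x y :
  \sum_k chi k (latvec x - latvec y) = if x == y then (L ^ d)%:R else 0.
Proof.
have -> : \sum_k chi k (latvec x - latvec y) =
    \sum_(k : {ffun 'I_d -> 'I_L}) \prod_i
      cexp (2 * pi * (L%:R^-1 * ((k i : nat)%:R * ((x i : nat)%:Z - (y i : nat)%:Z)%:~R))).
  apply: eq_bigr => k _; rewrite /chi -cexp_sum; congr cexp.
  by rewrite !mulr_sumr; apply: eq_bigr => i _; rewrite !mxE.
rewrite -(bigA_distr_bigA (fun i (j : 'I_L) => cexp (2 * pi * (L%:R^-1 * ((j : nat)%:R * ((x i : nat)%:Z - (y i : nat)%:Z)%:~R)))))/=.
rewrite (eq_bigr (fun i => if x i == y i then L%:R else 0)); last first.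
  move=> i _; rewrite sum_cexp; last by have := ltn_ord (x i); have := ltn_ord (y i); lia.
  by rewrite subr_eq0 eqz_nat.
have [->|/eqP xy] := eqVneq x y.
  by under eq_bigr do rewrite eqxx; rewrite prodr_const card_ord natrX.
have [i xi] : exists i, x i != y i.
  apply/existsP; apply: contra_notT xy; rewrite negb_exists => /forallP h.
  by apply/ffunP => i; apply/eqP; have := h i; rewrite negbK.
by rewrite (bigD1 i)//= (negbTE xi) mul0r.
Qed.

(** For fixed x, Euclidean division writes every integer vector uniquely as x - y + L m, the
    arguments that occur in [sigma2]. *)
Lemma esum_latvec (x : Lam) (a : 'rV[int]_d -> \bar R) : (forall v, (0 <= a v)%E) ->
  (\esum_(v in [set: 'rV[int]_d]) a v =
   \sum_(y : Lam) \esum_(m in [set: 'rV[int]_d]) a (latvec x - latvec y + L%:Z *: m)%R)%E.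
Proof.
move=> a0.
rewrite [RHS]fsbig_seq ?index_enum_uniq// -esum_fset; last 2 first.
- exact: finite_seq.
- by move=> y _; apply: esum_ge0.
rewrite (_ : [set` index_enum Lam] = setT); last first.
  by apply/seteqP; split => y //= _; exact: mem_index_enum.
rewrite (@esum_esum _ _ _ _ (fun=> setT) (fun y m => a (latvec x - latvec y + L%:Z *: m)%R))//.
rewrite (reindex_esum ([set: Lam] `*`` (fun=> [set: 'rV[int]_d])) setT
  (fun p => latvec x - latvec p.1 + L%:Z *: p.2)%R)//.
have LZ : L%:Z != 0 by rewrite eqz_nat -lt0n.
split => //.
- move=> [y m] [y' m'] _ _ /= /rowP h.
  have e i : y i = y' i /\ m 0 i = m' 0 i.
    have := h i; rewrite !mxE => hi.
    by have [-> /val_inj ->] := euclid_unique (ltn_ord (y i)) (ltn_ord (y' i)) hi.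
  by congr pair; [apply/ffunP => i|apply/rowP => i]; have [] := e i.
- move=> v _ /=.
  (* The point y is the remainder of x - v modulo L, and m is minus the quotient. *)
  pose r i := modz ((x i : nat)%:Z - v 0 i) L%:Z.
  pose t i := divz ((x i : nat)%:Z - v 0 i) L%:Z.
  have rt i : (x i : nat)%:Z - v 0 i = t i * L%:Z + r i by exact: divz_eq.
  have r0 i : 0 <= r i by exact: modz_ge0.
  have rL i : (`|r i| < L)%N by have := ltz_pmod ((x i : nat)%:Z - v 0 i) (_ : 0 < L%:Z); rewrite ltz_nat => /(_ L0); have := r0 i; rewrite -/(r i); lia.
  exists ([ffun i => Ordinal (rL i)], \row_i (- t i)) => //=.
  apply/rowP => i; rewrite !mxE ffunE /=.
  have := rt i.
  have -> : (`|r i|%N)%:Z = r i by rewrite gez0_abs.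
  rewrite mulrN [L%:Z * _]mulrC; move: (t i * L%:Z) (r i) ((x i : nat)%:Z) (v 0 i) => t' r' a' b'.
  lia.
Qed.

(** * The chain on the torus and its characters *)

Section Periodization.
Variables (k W C : R) (f : 'rV[R]_d -> R).
Hypotheses (k1 : 1 < k) (W0 : 0 < W) (df : dominated k C f) (f0 : forall u, 0 <= f u).

Definition periodized (x y : Lam) : R :=
  zsum (fun m => f (zpoint W (latvec x - latvec y + L%:Z *: m))).

Lemma sigma2E x y : sigma2 f W x y = periodized x y / lattice_sum W f.
Proof.
rewrite /sigma2 /Mnorm /periodized /lattice_sum; congr (_ / _); congr zsum; apply/funext => m; congr f; apply/rowP => i.
  by rewrite !mxE mulrC [m 0 i * _]mulrC.
by rewrite !mxE mulrC.
Qed.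

Lemma zsum_periodic (x : Lam) (b : 'rV[int]_d -> R) B : (forall v, 0 <= b v <= B) ->
  (forall v m, b (v + L%:Z *: m) = b v) ->
  zsum (fun v => f (zpoint W v) * b v) =
  \sum_y b (latvec x - latvec y) * periodized x y.
Proof.
move=> b0 bp; have fb v : 0 <= f (zpoint W v) * b v by rewrite mulr_ge0//; have /andP[] := b0 v.
rewrite /zsum (esum_latvec x); last by move=> v; rewrite lee_fin.
have fin y : (\esum_(m in [set: 'rV[int]_d]) (f (zpoint W (latvec x - latvec y + L%:Z *: m)))%:E)%E \is a fin_num.
  rewrite ge0_fin_numE; last by apply: esum_ge0 => m _; rewrite lee_fin.
  apply: (@le_lt_trans _ _ (\esum_(v in [set: 'rV[int]_d]) (f (zpoint W v))%:E)%E).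
    rewrite [leRHS](esum_latvec x); last by move=> v; rewrite lee_fin.
    rewrite (bigD1 y)//= leeDl// sume_ge0// => z _; apply: esum_ge0 => m _; by rewrite lee_fin.
  have /andP[_ h] := esum_dominated k1 W0 df f0.
  by rewrite (le_lt_trans h)// ltry.
rewrite (eq_bigr (fun y => (b (latvec x - latvec y) * periodized x y)%:E)) ?sumEFin//.
move=> y _; rewrite EFinM /periodized /zsum fineK//.
rewrite -esumZl//; last by have /andP[] := b0 (latvec x - latvec y).
by apply: eq_esum => m _; rewrite bp mulrC.
Qed.

Lemma periodized_ge0 x y : 0 <= periodized x y.
Proof. by rewrite /periodized /zsum fine_ge0// esum_ge0// => m _; rewrite lee_fin. Qed.

Lemma sum_periodized x : \sum_y periodized x y = lattice_sum W f.
Proof.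
rewrite /lattice_sum.
have := @zsum_periodic x (fun=> 1) 1 (fun=> _) (fun _ _ => erefl).
under eq_bigr do rewrite mul1r.
by move=> <-; [congr zsum; apply/funext => v; rewrite mulr1|rewrite ler01 lexx].
Qed.

Definition cos_lattice_sum (z : 'rV[R]_d) theta : R :=
  lattice_sum W (fun u => f u * (1 + cos (2 * pi * dotp z u + theta))) - lattice_sum W f.

(** Any representatives c of q modulo L give the same sum, since at lattice points adding e L to q_i
    changes the phase by a multiple of 2 pi. This lets the symmetric ones be used for the Poisson
    bound. *)
Lemma cos_lattice_sumE (q : Lam) (c : 'I_d -> int) theta x :
  (forall i, exists e : int, c i = (q i : nat)%:Z + e * L%:Z) ->
  cos_lattice_sum (\row_i (W / L%:R * (c i)%:~R)) theta =
  \sum_y (cos (2 * pi * (L%:R^-1 * \sum_i (q i : nat)%:R * ((latvec x - latvec y) 0 i)%:~R) + theta)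
     * periodized x y).
Proof.
move=> hc; rewrite /cos_lattice_sum.
have LR : L%:R != 0 :> R by rewrite pnatr_eq0 -lt0n.
pose b (v : 'rV[int]_d) := 1 + cos (2 * pi * (L%:R^-1 * \sum_i (q i : nat)%:R * (v 0 i)%:~R) + theta).
have b0 v : 0 <= b v <= 2.
  by rewrite /b -lerBlDl sub0r cos_geN1/= -[leRHS]/(1 + 1) lerD2l cos_le1.
have cosE (a a' : R) : cexp a = cexp a' -> cos (a + theta) = cos (a' + theta).
  by rewrite /cexp => -[e1 e2]; rewrite !cosD e1 e2.
have bp v m : b (v + L%:Z *: m) = b v.
  by congr (1 + _); apply: cosE; have := chiD q v (L%:Z *: m); rewrite chi_period mulr1.
have := zsum_periodic x b0 bp.
rewrite (_ : (fun v => f (zpoint W v) * b v) = (fun v => f (zpoint W v) *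
   (1 + cos (2 * pi * dotp (\row_i (W / L%:R * (c i)%:~R)) (zpoint W v) + theta)))); last first.
  apply/funext => v; congr (_ * (1 + _)); apply: cosE.
  have [e he] := choice hc.
  have -> : dotp (\row_i (W / L%:R * (c i)%:~R)) (zpoint W v) =
      L%:R^-1 * (\sum_i (q i : nat)%:R * (v 0 i)%:~R) + (\sum_i e i * v 0 i)%:~R.
    rewrite rmorph_sum/= mulr_sumr -big_split/=; apply: eq_bigr => i _.
    rewrite !mxE he intrD !intrM -[L%:Z%:~R]/(L%:R) -[(q i : nat)%:Z%:~R]/((q i : nat)%:R).
    by field; rewrite LR gt_eqF.
  by rewrite -[LHS]mulr1 -(cexp_int (\sum_i e i * v 0 i)) -cexpD [in RHS](mulrDr (2 * pi)).
rewrite /lattice_sum => ->; rewrite -/(lattice_sum W f) -(sum_periodized x) -sumrB.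
by apply: eq_bigr => y _; rewrite /b; ring.
Qed.

Implicit Types (x y z q : Lam) (n : nat).
Local Notation M := (lattice_sum W f).
Local Notation N := ((L ^ d)%:R : R).
Local Notation x0 := (lam0 d L0).

Lemma lattice_sum_ge0 : 0 <= M.
Proof. by have /andP[] := lattice_sum_bound k1 W0 df f0. Qed.

Lemma sigma2_ge0 x y : 0 <= sigma2 f W x y.
Proof. by rewrite sigma2E; apply: divr_ge0; [exact: periodized_ge0|exact: lattice_sum_ge0]. Qed.

(** M = 0 is not excluded here: then division by zero makes the matrix vanish, and the row sums are
    still at most 1. *)
Lemma sum_sigma2 x : \sum_y sigma2 f W x y = M / M.
Proof. by under eq_bigr do rewrite sigma2E; rewrite -mulr_suml sum_periodized. Qed.

Lemma sum_sigma2_le1 x : \sum_y sigma2 f W x y <= 1.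
Proof. by rewrite sum_sigma2; have [->|M0] := eqVneq M 0; rewrite ?mul0r// divff. Qed.

Lemma pn_ge0 n x y : 0 <= pn f W n x y.
Proof.
elim: n y => [|n IH] y /=; first by case: eqP.
by apply: sumr_ge0 => z _; rewrite mulr_ge0// sigma2_ge0.
Qed.

Lemma sum_pn_le1 n x : \sum_y pn f W n x y <= 1.
Proof.
elim: n => [|n IH] /=.
  rewrite (bigD1 x)//= eqxx big1 ?addr0// => y yx.
  by rewrite eq_sym (negbTE yx).
rewrite exchange_big/=; apply: le_trans IH; apply: ler_sum => z _.
by rewrite -mulr_sumr ler_piMr ?pn_ge0 ?sum_sigma2_le1.
Qed.

Lemma pn_le1 n x y : pn f W n x y <= 1.
Proof.
apply: le_trans (sum_pn_le1 n x); rewrite (bigD1 y)//= lerDl sumr_ge0// => z _.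
exact: pn_ge0.
Qed.

Definition phi (q : Lam) : R[i] := \sum_y (sigma2 f W x0 y)%:C * chi q (latvec x0 - latvec y).

Lemma phiE q (c : 'I_d -> int) x : (forall i, exists e : int, c i = (q i : nat)%:Z + e * L%:Z) ->
  \sum_y (sigma2 f W x y)%:C * chi q (latvec x - latvec y) =
  (cos_lattice_sum (\row_i (W / L%:R * (c i)%:~R)) 0 / M) +i*
  (cos_lattice_sum (\row_i (W / L%:R * (c i)%:~R)) (- (pi / 2)) / M).
Proof.
move=> hc; rewrite !(cos_lattice_sumE _ x hc) !mulr_suml -sum_complex.
apply: eq_bigr => y _; rewrite sigma2E /chi /cexp cosBpihalf addr0.
by apply/eqP; rewrite eq_complex/=; apply/andP; split; apply/eqP; ring.
Qed.

(** Translation invariance: the value given by [phiE] does not mention x. *)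
Lemma phi_indep q x : \sum_y (sigma2 f W x y)%:C * chi q (latvec x - latvec y) = phi q.
Proof.
have hc i : exists e : int, (q i : nat)%:Z = (q i : nat)%:Z + e * L%:Z.
  by exists 0; rewrite mul0r addr0.
by rewrite /phi !(phiE _ hc).
Qed.

(** Each step of the walk is a convolution, so it multiplies the transform by [phi q]; [phi_indep]
    lets the last step start from any z. *)
Lemma pn_transform n q :
  \sum_y (pn f W n x0 y)%:C * chi q (latvec x0 - latvec y) = phi q ^+ n.
Proof.
elim: n => [|n IH].
  rewrite (bigD1 x0)//= eqxx subrr chi_zero big1 ?mulr1 ?addr0 ?expr0// => y yx.
  by rewrite eq_sym (negbTE yx) mul0r.
rewrite exprSr -IH mulr_suml /=.
under eq_bigr do rewrite rmorph_sum/= mulr_suml.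
rewrite exchange_big/=; apply: eq_bigr => z _.
rewrite -(phi_indep q z) mulr_sumr; apply: eq_bigr => y _.
have -> : latvec x0 - latvec y = (latvec x0 - latvec z) + (latvec z - latvec y).
  by rewrite addrA subrK.
by rewrite chiD rmorphM/=; ring.
Qed.

Lemma pn_inversion n x :
  (N * pn f W n x0 x)%:C = \sum_q phi q ^+ n * chi q (latvec x - latvec x0).
Proof.
under eq_bigr do rewrite -pn_transform mulr_suml.
rewrite exchange_big/= (eq_bigr (fun y => (pn f W n x0 y)%:C * (if x == y then (L ^ d)%:R else 0))); last first.
  move=> y _; rewrite -(chi_orthogonality x y) mulr_sumr; apply: eq_bigr => q _.
  rewrite -mulrA -chiD; congr (_ * chi _ _).
  by rewrite addrC addrA subrK.
rewrite (bigD1 x)//= eqxx big1 ?addr0 => [|y yx]; last by rewrite eq_sym (negbTE yx) mulr0.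
by rewrite rmorphM/= rmorph_nat mulrC.
Qed.

Lemma chi_lam0 v : chi x0 v = 1.
Proof.
rewrite /chi big1 ?mulr0 ?cexp0// => i _; by rewrite ffunE mul0r.
Qed.

Lemma phi_lam0 : M != 0 -> phi x0 = 1.
Proof.
move=> M0; rewrite /phi; under eq_bigr do rewrite chi_lam0 mulr1.
by rewrite -rmorph_sum/= sum_sigma2 divff.
Qed.

Lemma norm_phi_le1 q : `|phi q| <= 1.
Proof.
apply: le_trans (ler_norm_sum _ _ _) _.
rewrite (eq_bigr (fun y => (sigma2 f W x0 y)%:C)); last first.
  by move=> y _; rewrite normrM norm_chi mulr1 ger0_norm// lecR sigma2_ge0.
by rewrite -rmorph_sum/= -[1]/(1%:C) lecR sum_sigma2_le1.
Qed.

Lemma pn_distance n x (b : Lam -> R) : M != 0 ->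
  (forall q, q != x0 -> `|phi q| ^+ n <= (b q)%:C) ->
  `|pn f W n x0 x - N^-1| <= N^-1 * \sum_(q | q != x0) b q.
Proof.
move=> M0 hb; have N0 : 0 < N by rewrite ltr0n expn_gt0 L0.
rewrite -(ler_pM2l N0) [leRHS]mulrA divff ?gt_eqF// mul1r -{1}(gtr0_norm N0) -normrM mulrBr divff ?gt_eqF//.
have nC (r : R) : `|r%:C| = `|r|%:C by rewrite normc_def/= expr0n/= addr0 sqrtr_sqr.
rewrite -lecR -nC rmorphB/= pn_inversion (bigD1 x0)//= phi_lam0// expr1n chi_lam0 mulr1.
rewrite addrAC subrr add0r rmorph_sum/=.
apply: le_trans (ler_norm_sum _ _ _) _; apply: ler_sum => q qx.
by rewrite normrM norm_chi mulr1 normrX hb.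
Qed.

End Periodization.

End FiniteFourier.

(** * The estimate *)

Section RealEstimates.
Variable R : realType.

(** Write e^-k as a product of d factors e^(-k/d) and use a different coordinate in each. The scale
    a covers lower bounds that hold only up to a constant. *)
Lemma powR_prod_pweight (k : R) d (u : 'rV[R]_d) (a e : R) : (0 < d)%N -> 0 <= k -> 0 < a ->
  (forall i, a * (1 + `|u 0 i|) <= e) ->
  e `^ (- k) <= a `^ (- k) * \prod_(i < d) pweight (k / d%:R) (u 0 i).
Proof.
move=> d0 k0 a0 h; have dR : d%:R != 0 :> R by rewrite pnatr_eq0 -lt0n.
have b0 i : 0 < 1 + `|u 0 i| by rewrite ltr_pwDl.
have e0 : 0 < e by apply: lt_le_trans (h (Ordinal d0)); rewrite mulr_gt0.
have pw (x : R) : 0 < x -> x `^ (- k) = \prod_(i < d) x `^ (- (k / d%:R)).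
  move=> x0; rewrite prodr_const card_ord -powR_mulrn ?powR_ge0// -powRrM; congr (_ `^ _).
  by rewrite mulNr divfK.
rewrite !pw// -big_split/=; apply: ler_prod => i _; rewrite powR_ge0/= /pweight.
rewrite -powRM ?(ltW a0) ?(ltW (b0 i))// !powRN lef_pV2 ?posrE ?powR_gt0 ?mulr_gt0//.
by apply: ge0_ler_powR; rewrite ?divr_ge0// ?nnegrE ?(ltW e0) ?mulr_ge0 ?(ltW a0) ?(ltW (b0 i)).
Qed.

Lemma intr_norm_ge1 (z : int) : z != 0 -> 1 <= `|z%:~R| :> R.
Proof. by move=> z0; rewrite -intr_norm -[1]/(1%:~R) ler_int; lia. Qed.

Lemma enorm_ge0 d (u : 'rV[R]_d) : 0 <= enorm u.
Proof. exact: sqrtr_ge0. Qed.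

Lemma enorm_ge d (u : 'rV[R]_d) i : `|u 0 i| <= enorm u.
Proof.
rewrite /enorm -sqrtr_sqr ler_sqrt ?sumr_ge0// => [|*]; last exact: sqr_ge0.
by rewrite (bigD1 i)//= lerDl sumr_ge0// => *; exact: sqr_ge0.
Qed.

Lemma enormZ d (u : 'rV[R]_d) a : 0 <= a -> enorm (a *: u) = a * enorm u.
Proof.
move=> a0; rewrite /enorm.
under eq_bigr do rewrite mxE exprMn.
by rewrite -mulr_sumr sqrtrM ?sqr_ge0// sqrtr_sqr ger0_norm.
Qed.

(** Raise y <= exp y, with y = c x / p, to the power p. *)
Lemma powR_expR_bound (p c x : R) : 0 < p -> 0 < c -> 0 <= x ->
  x `^ p * expR (- (c * x)) <= (p / c) `^ p.
Proof.
move=> p0 c0 x0.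
have h : c * x / p <= expR (c * x / p).
  by apply: le_trans (expR_ge1Dx _); rewrite lerDr.
have cxp : 0 <= c * x / p by rewrite !mulr_ge0 ?invr_ge0 ?(ltW c0) ?(ltW p0).
have : (c * x / p) `^ p <= expR (c * x).
  have -> : expR (c * x) = expR (c * x / p) `^ p.
    by rewrite /powR gt_eqF ?expR_gt0// expRK; congr expR; field; rewrite gt_eqF.
  by apply: ge0_ler_powR; rewrite ?nnegrE ?expR_ge0 ?(ltW p0).
move=> h2; have e : x = (p / c) * (c * x / p) by field; rewrite !gt_eqF.
have -> : x `^ p = (p / c) `^ p * (c * x / p) `^ p.
  by rewrite [in LHS]e powRM// divr_ge0 ?(ltW p0) ?(ltW c0).
rewrite expRN -mulrA ler_piMr ?powR_ge0//.
by rewrite ler_pdivrMr ?expR_gt0// mul1r.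
Qed.

(** All factors are at most 1, so each of the n replacements of s by t costs at most de: the origin
    of the factor n before W^-K. *)
Lemma expr_le_add (s t de : R) n : 0 <= s <= 1 -> 0 <= t <= 1 -> 0 <= de -> s <= t + de ->
  s ^+ n <= t ^+ n + n%:R * de.
Proof.
move=> /andP[s0 s1] /andP[t0 t1] de0 st.
elim: n => [|n IH]; first by rewrite !expr0 mul0r addr0.
rewrite !exprS; apply: le_trans (ler_wpM2l s0 IH) _.
have tn : t ^+ n <= 1 by rewrite exprn_ile1.
have tn0 : 0 <= t ^+ n by rewrite exprn_ge0.
have nde : 0 <= n%:R * de by rewrite mulr_ge0.
have h1 : s * t ^+ n <= t * t ^+ n + de.
  apply: le_trans (ler_wpM2r tn0 st) _; rewrite mulrDl lerD2l.
  by rewrite ler_piMr.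
have h2 : s * (n%:R * de) <= n%:R * de by rewrite ler_piMl.
by rewrite mulrDr -natr1 mulrDl mul1r; lra.
Qed.

Lemma norm_complex_le (z : R[i]) (a b : R) :
  `|complex.Re z| <= a -> `|complex.Im z| <= b -> `|z| <= (a + b)%:C.
Proof.
move=> ha hb; rewrite normc_def lecR.
have a0 : 0 <= a := le_trans (normr_ge0 _) ha; have b0 : 0 <= b := le_trans (normr_ge0 _) hb.
rewrite -[leRHS]ger0_norm ?addr_ge0// -sqrtr_sqr ler_sqrt ?sqr_ge0//.
have h1 : complex.Re z ^+ 2 <= a ^+ 2 by rewrite -[leLHS]real_normK ?num_real// ler_sqr ?nnegrE.
have h2 : complex.Im z ^+ 2 <= b ^+ 2 by rewrite -[leLHS]real_normK ?num_real// ler_sqr ?nnegrE.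
have := mulr_ge0 a0 b0; rewrite sqrrD; lra.
Qed.

End RealEstimates.

(** * Symmetric representatives and the sum over nonzero frequencies *)

Section SymmetricResidue.
Variables (R : realType) (L : nat).
Hypothesis L0 : (0 < L)%N.

Definition symres (j : 'I_L) : int := if (2 * j <= L)%N then Posz j else Posz j - Posz L.

Lemma symres_mod j : exists e : int, symres j = (j : nat)%:Z + e * L%:Z.
Proof.
rewrite /symres; case: ifP => _; first by exists 0; rewrite mul0r addr0.
by exists (-1); rewrite mulN1r.
Qed.

Lemma symres_inj : injective symres.
Proof.
move=> i j; rewrite /symres => h; apply: val_inj => /=; move: h.
have := ltn_ord i; have := ltn_ord j.
by case: ifP; case: ifP; lia.
Qed.

Lemma symres_eq0 j : symres j = 0 -> j = 0%N :> nat.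
Proof. by rewrite /symres; have := ltn_ord j; case: ifP; lia. Qed.

Lemma symres_le j : `|L%:R^-1 * (symres j)%:~R| <= 2^-1 :> R.
Proof.
have LR : 0 < L%:R :> R by rewrite ltr0n.
rewrite normrM gtr0_norm ?invr_gt0// mulrC ler_pdivrMr// mulrC ler_pdivlMr//.
rewrite -intr_norm -[L%:R]/(L%:Z%:~R) -[2]/(2%:Z%:~R) -intrM ler_int /symres.
by have := ltn_ord j; case: ifP; lia.
Qed.

Lemma sum_symres (d : nat) (k s : R) : (0 < d)%N -> d%:R < k -> 0 < s ->
  \sum_(q : Lam d L | q != lam0 d L0)
    (1 + s * enorm (\row_i (symres (q i))%:~R : 'rV[R]_d)) `^ (- k)
  <= 2 `^ k * (1 + 2 / (k / d%:R - 1)) ^+ d * s^-1 ^+ d.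
Proof.
move=> d0 dk s0; have dR : 0 < d%:R :> R by rewrite ltr0n.
have k0 : 0 <= k by apply: ltW; apply: lt_trans dk.
have kd1 : 1 < k / d%:R by rewrite ltr_pdivlMr// mul1r.
have kd0 : 0 < k / d%:R - 1 by rewrite subr_gt0.
set S := 1 + _; have S1 : 1 <= S by rewrite /S lerDl divr_ge0 ?ltW.
have S0 : 0 <= S by apply: le_trans S1.
have two1 : 1 <= 2 `^ k :> R.
  by rewrite -[leLHS](powRr0 2) ler_powR// ler1n.
pose v (q : Lam d L) : 'rV[R]_d := \row_i (symres (q i))%:~R.
have prod_sum (t : R) : 0 < t ->
    \sum_(q : Lam d L) \prod_i pweight (k / d%:R) (t * v q 0 i) <= (1 + 2 / ((k / d%:R - 1) * t)) ^+ d.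
  move=> t0; under eq_bigr do under eq_bigr do rewrite mxE.
  rewrite -(bigA_distr_bigA (fun (i : 'I_d) (j : 'I_L) => pweight (k / d%:R) (t * (symres j)%:~R)))/=.
  have -> : (1 + 2 / ((k / d%:R - 1) * t)) ^+ d = \prod_(i < d) (1 + 2 / ((k / d%:R - 1) * t)).
    by rewrite prodr_const card_ord.
  apply: ler_prod => i _; rewrite sumr_ge0/=; last by move=> *; exact: pweight_ge0.
  by apply: sum_pweight_inj => //; exact: symres_inj.
(* For s <= 1 the product of one-dimensional sums already has order s^-d, because 1 + c / s <= (1 +
   c) / s, and the term q = 0 may be included. *)
have [s1|s1] := leP s 1.
  apply: (@le_trans _ _ (\sum_(q : Lam d L) \prod_i pweight (k / d%:R) (s * v q 0 i))).
    rewrite [leRHS](bigID (fun q => q != lam0 d L0))/= -[leLHS]addr0 lerD//.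
      apply: ler_sum => q _.
      have := @powR_prod_pweight _ k d (s *: v q) 1 (1 + s * enorm (v q)) d0 k0 ltr01.
      rewrite powR1 mul1r.
      have -> : \prod_(i < d) pweight (k / d%:R) ((s *: v q) 0 i) = \prod_(i < d) pweight (k / d%:R) (s * v q 0 i).
        by apply: eq_bigr => i _; rewrite mxE.
      apply=> i; rewrite mul1r lerD2l -enormZ ?(ltW s0)//; exact: enorm_ge.
    by apply: sumr_ge0 => q _; apply: prodr_ge0 => i _; exact: pweight_ge0.
  apply: le_trans (prod_sum s s0) _.
  rewrite -mulrA -exprMn; apply: (@le_trans _ _ ((S * s^-1) ^+ d)); last first.
    by rewrite ler_peMl// exprn_ge0// mulr_ge0// invr_ge0 ltW.
  apply: lerXn2r; rewrite ?nnegrE.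
  - by rewrite addr_ge0// divr_ge0// mulr_ge0 ?(ltW s0) ?(ltW kd0).
  - by rewrite mulr_ge0// invr_ge0 ltW.
  rewrite /S; set kk := k / d%:R - 1 in kd0 *.
  have -> : (1 + 2 / kk) / s = s^-1 + 2 / (kk * s) by field; rewrite !gt_eqF.
  by rewrite lerD2r invf_ge1.
(* For s > 1 the exclusion of q = 0 matters: a nonzero integer vector has norm at least 1, so s |v|
   >= (s / 2)(1 + |v_i|) for every i. The factor (s / 2)^-k yields the 2^k, and s^-k <= s^-d. *)
have sh : 0 < s / 2 by rewrite divr_gt0.
apply: (@le_trans _ _ (\sum_(q : Lam d L) (s / 2) `^ (- k) * \prod_i pweight (k / d%:R) (1 * v q 0 i))).
  rewrite [leRHS](bigID (fun q => q != lam0 d L0))/= -[leLHS]addr0 lerD//; last first.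
    by apply: sumr_ge0 => q _; rewrite mulr_ge0 ?powR_ge0//; apply: prodr_ge0 => i _; exact: pweight_ge0.
  apply: ler_sum => q q0.
  under eq_bigr do rewrite mul1r.
  apply: powR_prod_pweight => // i.
  have [j qj] : exists j, q j != lam0 d L0 j.
    apply/existsP; apply: contra_neqT q0; rewrite negb_exists => /forallP h.
    by apply/ffunP => j; apply/eqP; have := h j; rewrite negbK.
  have nj : 1 <= enorm (v q).
    apply: le_trans (enorm_ge _ j); rewrite mxE; apply: intr_norm_ge1.
    by apply: contra_neq qj => /symres_eq0 h; apply: val_inj; rewrite ffunE/=; exact: h.
  have hi := enorm_ge (v q) i.
  have hm : (1 + `|v q 0 i|) / 2 <= enorm (v q).
    lra.
  have := ler_wpM2l (ltW s0) hm; lra.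
rewrite -mulr_sumr; apply: le_trans (ler_wpM2l (powR_ge0 _ _) (prod_sum 1 ltr01)) _.
rewrite mulr1 -/S [leRHS]mulrAC ler_wpM2r ?exprn_ge0// powRM ?(ltW s0) ?invr_ge0//.
have -> : 2^-1 `^ (- k) = 2 `^ k :> R by rewrite -powR_inv1// -powRrM mulN1r opprK.
rewrite mulrC ler_wpM2l ?powR_ge0//.
rewrite -powR_mulrn ?invr_ge0 ?(ltW s0)// -powR_inv1 ?(ltW s0)// -powRrM mulN1r.
by rewrite ler_powR ?(ltW s1)// lerN2 ltW.
Qed.

End SymmetricResidue.

(** * From the assumptions on f to the bound for the chain *)

Section MainEstimate.
Variables (R : realType) (d : nat) (f : 'rV[R]_d -> R).
Variables (alpha c0 eps rho T K CT CK : R).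
Hypotheses (d0 : (0 < d)%N) (alpha0 : 0 < alpha) (c0_gt0 : 0 < c0) (rho01 : 0 < rho < 1).
Hypotheses (f0 : forall u, 0 <= f u) (f_int : iint f = 1).
Hypothesis f_small : forall xi, enorm xi <= eps -> fourier_abs f xi <= expR (- (c0 * enorm xi `^ alpha)).
Hypothesis f_large : forall xi, eps < enorm xi -> fourier_abs f xi <= rho.
Hypotheses (f_cont : continuous f) (dT : d%:R < T) (dK : d%:R < K) (CK0 : 0 < CK).
Hypothesis f_decay : forall u, f u <= CT * (1 + enorm u) `^ (- T).
Hypothesis fourier_decay : forall xi, fourier_abs f xi <= CK * (1 + enorm xi) `^ (- K).

Let dR : 0 < d%:R :> R. Proof. by rewrite ltr0n. Qed.
Let tau := T / d%:R.
Let kap := K / d%:R.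
Let tau1 : 1 < tau. Proof. by rewrite /tau ltr_pdivlMr// mul1r. Qed.
Let kap1 : 1 < kap. Proof. by rewrite /kap ltr_pdivlMr// mul1r. Qed.
Let T0 : 0 < T. Proof. exact: lt_trans dT. Qed.
Let K0 : 0 < K. Proof. exact: lt_trans dK. Qed.
Let S := 1 + 2 / (kap - 1).
Let S_ge1 : 1 <= S. Proof. by rewrite /S lerDl divr_ge0// subr_ge0 ltW. Qed.
Let S_gt0 : 0 < S. Proof. exact: lt_le_trans S_ge1. Qed.

Lemma f_dominated : dominated tau CT f.
Proof.
split => // u; rewrite ger0_norm//.
have CT0 : 0 <= CT.
  by have := le_trans (f0 0) (f_decay 0); rewrite pmulr_lge0// powR_gt0// ltr_pwDl// enorm_ge0.
apply: le_trans (f_decay u) _; rewrite ler_wpM2l//.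
have := @powR_prod_pweight R T d u 1 (1 + enorm u) d0 (ltW T0) ltr01.
by rewrite powR1 mul1r; apply=> i; rewrite mul1r lerD2l enorm_ge.
Qed.

Lemma fourier_abs_ge0 xi : 0 <= fourier_abs f xi.
Proof. exact: sqrtr_ge0. Qed.

Lemma fourier_abs_le1 xi : fourier_abs f xi <= 1.
Proof.
have [h|h] := leP (enorm xi) eps.
  apply: le_trans (f_small h) _; rewrite -[leRHS]expR0 ler_expR oppr_le0.
  by rewrite mulr_ge0 ?powR_ge0 ?(ltW c0_gt0).
by apply: le_trans (f_large h) _; move: rho01 => /andP[_ /ltW].
Qed.

(** The 2 comes from [norm_fourier_cos], 4^K from the distance W / 4 in [fourier_tail], and S^d from
    the sum over nonzero frequencies. *)
Definition tail_const : R := 2 * CK * 4 `^ K * S ^+ d.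

Lemma tail_const_gt0 : 0 < tail_const.
Proof. by rewrite /tail_const !mulr_gt0// ?powR_gt0 ?exprn_gt0. Qed.

(** Uniform in n: for a fixed first index of a pair the differences are distinct and their weights
    add up to at most S, so each coordinate gives n S, and the n cancels. *)
Lemma fourier_tail (W theta : R) (xi : 'rV[R]_d) n : 0 < W -> (forall i, `|xi 0 i| <= 2^-1) -> (0 < n)%N ->
  n%:R^-1 ^+ d * \sum_(P : {ffun 'I_d -> 'I_n * 'I_n} | freq P != 0)
     `|fourier_cos f theta (W *: xi + W *: map_mx intr (freq P))| <= tail_const * W `^ (- K).
Proof.
move=> W0 hxi n0; have nR : 0 < n%:R :> R by rewrite ltr0n.
have W4 : 0 < W / 4 by rewrite divr_gt0.
have term (P : {ffun 'I_d -> 'I_n * 'I_n}) : freq P != 0 ->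
    `|fourier_cos f theta (W *: xi + W *: map_mx intr (freq P))| <=
    2 * CK * (W / 4) `^ (- K) * \prod_i pweight kap (((P i).1 : nat)%:Z - ((P i).2 : nat)%:Z)%:~R.
  move=> P0; apply: le_trans (norm_fourier_cos tau1 theta _ f_dominated) _.
  rewrite -!mulrA ler_wpM2l//; apply: le_trans (fourier_decay _) _; rewrite ler_wpM2l ?(ltW CK0)//.
  have -> : \prod_i pweight kap (((P i).1 : nat)%:Z - ((P i).2 : nat)%:Z)%:~R =
      \prod_i pweight kap ((map_mx intr (freq P) : 'rV[R]_d) 0 i).
    by apply: eq_bigr => i _; rewrite !mxE.
  apply: powR_prod_pweight => //; first exact: ltW.
  set m : 'rV[R]_d := map_mx intr (freq P).
  have nz i : freq P 0 i != 0 -> 1 <= `|m 0 i| /\ W * (`|m 0 i| - 2^-1) <= enorm (W *: xi + W *: m).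
    move=> z0; split.
      by rewrite mxE; exact: intr_norm_ge1.
    apply: le_trans (enorm_ge _ i); rewrite !mxE -mulrDr normrM (gtr0_norm W0) ler_wpM2l ?(ltW W0)//.
    set t := _%:~R; have h := hxi i; have := ler_normB (xi 0 i + t) (xi 0 i).
    by rewrite [xi 0 i + t]addrC addrK; lra.
  have [j Pj] : exists j, freq P 0 j != 0.
    apply/existsP; apply: contra_neqT P0; rewrite negb_exists => /forallP h.
    by apply/rowP => j; apply/eqP; have := h j; rewrite negbK => /eqP ->; rewrite mxE.
  have [j1 j2] := nz j Pj.
  (* A coordinate where m vanishes borrows the lower bound W / 2 from the nonzero coordinate j;
     elsewhere |m_i| - 1/2 >= (1 + |m_i|) / 4, the source of W / 4. *)
  move=> i; have [z0|z0] := eqVneq (freq P 0 i) 0.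
    rewrite [m 0 i]mxE z0 normr0 addr0 mulr1.
    have : W * 2^-1 <= W * (`|m 0 j| - 2^-1) by rewrite ler_wpM2l ?(ltW W0)//; lra.
    lra.
  have [i1 i2] := nz i z0.
  have : W * ((1 + `|m 0 i|) / 4) <= W * (`|m 0 i| - 2^-1) by rewrite ler_wpM2l ?(ltW W0)//; lra.
  lra.
set A := 2 * CK * (W / 4) `^ (- K) in term.
have A0 : 0 <= A by rewrite /A !mulr_ge0 ?powR_ge0 ?(ltW CK0).
apply: (@le_trans _ _ (n%:R^-1 ^+ d * (A * (n%:R * S) ^+ d))).
  rewrite ler_wpM2l ?exprn_ge0 ?invr_ge0//.
  apply: (@le_trans _ _ (\sum_(P : {ffun 'I_d -> 'I_n * 'I_n})
     A * \prod_i pweight kap (((P i).1 : nat)%:Z - ((P i).2 : nat)%:Z)%:~R)).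
    rewrite [leRHS](bigID (fun P => freq P != 0))/= -[leLHS]addr0 lerD//; first exact: ler_sum.
    by apply: sumr_ge0 => P _; rewrite mulr_ge0//; apply: prodr_ge0 => i _; exact: pweight_ge0.
  rewrite -mulr_sumr ler_wpM2l//.
  rewrite -(bigA_distr_bigA (fun (i : 'I_d) (p : 'I_n * 'I_n) => pweight kap ((p.1 : nat)%:Z - (p.2 : nat)%:Z)%:~R))/=.
  have -> : (n%:R * S) ^+ d = \prod_(i < d) (n%:R * S) by rewrite prodr_const card_ord.
  apply: ler_prod => i _; rewrite sumr_ge0/=; last by move=> *; exact: pweight_ge0.
  rewrite -(pair_bigA _ (fun j k : 'I_n => pweight kap ((j : nat)%:Z - (k : nat)%:Z)%:~R))/=.
  have -> : n%:R * S = \sum_(j < n) S by rewrite sumr_const card_ord -[RHS]mulr_natl.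
  apply: ler_sum => j _.
  have := @sum_pweight_inj R kap 1 'I_n (fun k => (j : nat)%:Z - (k : nat)%:Z) kap1 ltr01.
  rewrite mulr1 => h.
  rewrite (eq_bigr (fun k : 'I_n => pweight kap (1 * ((j : nat)%:Z - (k : nat)%:Z)%:~R))).
    by apply: h => k k' /addrI /oppr_inj [] /val_inj.
  by move=> k _; rewrite mul1r.
rewrite mulrCA -exprMn mulKf ?gt_eqF// /A /tail_const.
rewrite powRM ?(ltW W0) ?invr_ge0// -[4^-1]powR_inv1// -powRrM mulN1r opprK.
by rewrite le_eqVlt; apply/orP; left; apply/eqP; ring.
Qed.

(** The conjugate of the Fourier transform at z, that is its value at -z: the sign that matches
    [chi]. *)
Definition fhat (z : 'rV[R]_d) : R[i] := fourier_cos f 0 z +i* fourier_cos f (- (pi / 2)) z.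

Lemma fhat_norm z : `|fhat z| = (fourier_abs f z)%:C.
Proof.
rewrite normc_def /= /fourier_abs; congr (Num.sqrt (_ + _))%:C.
  by congr (_ ^+ 2); congr iint; apply/funext => u; rewrite addr0.
rewrite /fourier_im sqrrN; congr (_ ^+ 2); congr iint; apply/funext => u.
by rewrite cosBpihalf.
Qed.

Lemma rho_decay : exists2 D : R, 0 < D & forall n, (0 < n)%N ->
  rho ^+ n.-1 <= D * n%:R `^ (- (d%:R / alpha)).
Proof.
have /andP[rho0 rho1] := rho01; pose c := - ln rho; pose q := d%:R / alpha.
have c_gt0 : 0 < c by rewrite oppr_gt0 ln_lt0// rho0.
have q0 : 0 < q by rewrite divr_gt0.
exists ((q / c) `^ q / rho) => [|n n0]; first by apply: divr_gt0 => //; apply: powR_gt0; exact: divr_gt0.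
have nR : 0 < n%:R :> R by rewrite ltr0n.
have h : n%:R `^ q * rho ^+ n <= (q / c) `^ q.
  have := powR_expR_bound q0 c_gt0 (ltW nR).
  suff -> : expR (- (c * n%:R)) = rho ^+ n by [].
  by rewrite /c mulNr opprK mulrC expRM_natl lnK.
rewrite powRN -/q ler_pdivlMr ?powR_gt0// ler_pdivlMr//.
apply: le_trans h; rewrite mulrC mulrA -exprS prednK// mulrC//.
Qed.

(** The exponent K is chosen so that [sum_symres] applies to the result. *)
Lemma expR_pow_decay : exists2 D : R, 0 < D & forall r, 0 <= r ->
  expR (- (c0 * r `^ alpha)) <= D * (1 + r) `^ (- K).
Proof.
pose p := K / alpha; have p0 : 0 < p by rewrite divr_gt0.
have P0 : 0 <= (p / c0) `^ p by exact: powR_ge0.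
exists (2 `^ K * (1 + (p / c0) `^ p)) => [|r r0].
  by rewrite mulr_gt0// ?powR_gt0// ltr_pwDl.
have r1 : 0 < 1 + r by rewrite ltr_pwDl.
(* 1 + r is at most 2 when r <= 1 and at most 2 r otherwise. *)
have h1 : (1 + r) `^ K <= 2 `^ K * (1 + r `^ K).
  have [rle|rgt] := leP r 1.
    apply: (@le_trans _ _ (2 `^ K)).
      by apply: ge0_ler_powR; rewrite ?nnegrE ?(ltW K0) ?(ltW r1)//; lra.
    by rewrite ler_peMr ?powR_ge0// lerDl powR_ge0.
  apply: (@le_trans _ _ (2 `^ K * r `^ K)); last by rewrite ler_wpM2l ?powR_ge0// lerDr.
  rewrite -powRM//; apply: ge0_ler_powR; rewrite ?nnegrE ?(ltW K0) ?(ltW r1) ?mulr_ge0//; lra.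
have h2 : r `^ K * expR (- (c0 * r `^ alpha)) <= (p / c0) `^ p.
  have := powR_expR_bound p0 c0_gt0 (powR_ge0 r alpha).
  by rewrite -powRrM /p mulrCA divff ?gt_eqF// mulr1.
have e1 : expR (- (c0 * r `^ alpha)) <= 1.
  by rewrite -[leRHS]expR0 ler_expR oppr_le0 mulr_ge0 ?powR_ge0 ?(ltW c0_gt0).
rewrite powRN ler_pdivlMr ?powR_gt0// mulrC.
apply: le_trans (ler_wpM2r (expR_ge0 _) h1) _.
by rewrite -mulrA ler_wpM2l ?powR_ge0// mulrDl mul1r lerD.
Qed.

(** For small z the n-th power of exp (- c0 |z|^alpha) is the same function at n^(1/alpha) |z|. For
    large z, n - 1 factors are bounded by rho and the last one by assumption (4). *)
Lemma fourier_pow_decay : exists2 D : R, 0 < D & forall n, (0 < n)%N -> forall z,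
  fourier_abs f z ^+ n <= D * ((1 + n%:R `^ alpha^-1 * enorm z) `^ (- K) +
    n%:R `^ (- (d%:R / alpha)) * (1 + enorm z) `^ (- K)).
Proof.
have [D1 D10 hD1] := expR_pow_decay; have [D2 D20 hD2] := rho_decay.
exists (D1 + D2 * CK) => [|n n0 z]; first by rewrite addr_gt0// mulr_gt0.
have DC : 0 <= D2 * CK by rewrite mulr_ge0 ?(ltW D20) ?(ltW CK0).
set X := (_ `^ (- K)); set Y := _ * _ `^ (- K).
have X0 : 0 <= X by exact: powR_ge0.
have Y0 : 0 <= Y by rewrite mulr_ge0 ?powR_ge0.
have [small|large] := leP (enorm z) eps.
  apply: (@le_trans _ _ (D1 * X)); last first.
    by apply: ler_pM => //; rewrite ?(ltW D10) ?lerDl.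
  have r0 : 0 <= n%:R `^ alpha^-1 * enorm z by rewrite mulr_ge0 ?powR_ge0 ?enorm_ge0.
  apply: le_trans (hD1 _ r0).
  apply: (@le_trans _ _ (expR (- (c0 * enorm z `^ alpha)) ^+ n)).
    by apply: lerXn2r; rewrite ?nnegrE ?fourier_abs_ge0 ?expR_ge0 ?f_small.
  rewrite -expRM_natl powRM ?powR_ge0 ?enorm_ge0// -powRrM mulVf ?gt_eqF// powRr1//.
  by rewrite mulrN mulrCA.
apply: (@le_trans _ _ (D2 * CK * Y)); last first.
  by apply: ler_pM => //; rewrite ?lerDr ?(ltW D10).
rewrite -{1}(prednK n0) exprSr.
apply: (@le_trans _ _ (rho ^+ n.-1 * (CK * (1 + enorm z) `^ (- K)))).
  apply: ler_pM; rewrite ?exprn_ge0 ?fourier_abs_ge0//.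
  by apply: lerXn2r; rewrite ?nnegrE ?fourier_abs_ge0 ?f_large//; have /andP[/ltW] := rho01.
apply: le_trans (ler_wpM2r _ (hD2 n n0)) _; first by rewrite mulr_ge0 ?powR_ge0 ?(ltW CK0).
by rewrite /Y le_eqVlt; apply/orP; left; apply/eqP; ring.
Qed.

Section FixedScale.
Variables (L : nat) (L0 : (0 < L)%N) (W : R) (W0 : 0 < W).
Local Notation M := (lattice_sum W f).
Local Notation B := (tail_const * W `^ (- K)).
Local Notation df := f_dominated.

Definition freqvec (q : Lam d L) : 'rV[R]_d := \row_i (W / L%:R * (symres (q i))%:~R).

Lemma freqvecE q : freqvec q = W *: \row_i (L%:R^-1 * (symres (q i))%:~R).
Proof. by apply/rowP => i; rewrite !mxE mulrA. Qed.

Lemma poisson_freqvec theta q :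
  `|W^-1 ^+ d * cos_lattice_sum W f (freqvec q) theta - fourier_cos f theta (freqvec q)| <= B.
Proof.
apply: (poisson_bound tau1 W0 df f0) => n n0; rewrite freqvecE.
by apply: fourier_tail => // i; rewrite mxE; exact: symres_le.
Qed.

(** Poisson summation at frequency 0 and phase 0, where the cosine is 1 and the integral of f is
    1. *)
Lemma mass_close : `|W^-1 ^+ d * M - 1| <= B.
Proof.
have := poisson_freqvec 0 (lam0 d L0).
have -> : freqvec (lam0 d L0) = 0.
  by apply/rowP => i; rewrite !mxE ffunE /symres/= mulr0.
have -> : fourier_cos f 0 0 = 1.
  rewrite -f_int; congr iint; apply/funext => u.
  by rewrite /dotp big1 ?mulr0 ?addr0 ?cos0 ?mulr1// => i _; rewrite mxE mul0r.
suff -> : cos_lattice_sum W f 0 0 = M by [].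
have -> : 0 = \row_i (W / L%:R * ((fun=> 0) i : int)%:~R) :> 'rV[R]_d.
  by apply/rowP => i; rewrite !mxE mulr0.
rewrite (cos_lattice_sumE L0 tau1 W0 df f0 (q := lam0 d L0) _ (lam0 d L0)).
  rewrite -(sum_periodized L0 tau1 W0 df f0 (lam0 d L0)); apply: eq_bigr => y _.
  by rewrite big1 ?mulr0 ?addr0 ?cos0 ?mul1r// => i _; rewrite ffunE mul0r.
by move=> i; exists 0; rewrite mul0r addr0 ffunE.
Qed.

Lemma phi_close q : B <= 2^-1 -> `|phi L0 W f q - fhat (freqvec q)| <= (12 * B)%:C.
Proof.
move=> B2; have B0 : 0 <= B by rewrite mulr_ge0 ?powR_ge0 ?(ltW tail_const_gt0).
have hc i : exists e : int, symres (q i) = (q i : nat)%:Z + e * L%:Z by exact: symres_mod.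
have Wd0 : 0 < W^-1 ^+ d by rewrite exprn_gt0// invr_gt0.
rewrite /phi (phiE L0 tau1 W0 df f0 _ hc) -/(freqvec q).
have := mass_close; set mu := _ * M => hmu.
have mu2 : 2^-1 <= mu by move: hmu; rewrite ler_norml => /andP[]; lra.
have mu0 : 0 < mu by apply: lt_le_trans mu2; rewrite invr_gt0.
have M0 : 0 < M by move: mu0; rewrite /mu pmulr_rgt0.
have part theta : `|cos_lattice_sum W f (freqvec q) theta / M - fourier_cos f theta (freqvec q)| <= 6 * B.
  have := poisson_freqvec theta q; set a := W^-1 ^+ d * _; set F0 := fourier_cos _ _ _ => ha.
  (* This separates the error of the numerator from that of the normalisation: B + 2 B, divided by
     mu >= 1/2, gives 6 B. *)
  have -> : cos_lattice_sum W f (freqvec q) theta / M - F0 = ((a - F0) + F0 * (1 - mu)) / mu.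
    by rewrite /a /mu; field; rewrite !gt_eqF.
  have F1 : `|F0| <= 2.
    apply: le_trans (norm_fourier_cos tau1 theta _ df) _.
    by rewrite -[leRHS]mulr1 ler_wpM2l// fourier_abs_le1.
  rewrite normrM normfV (gtr0_norm mu0) ler_pdivrMr//.
  apply: le_trans (ler_normD _ _) _; rewrite normrM distrC in hmu *.
  have := ler_pM (normr_ge0 _) (normr_ge0 _) F1 hmu.
  have : 6 * B * 2^-1 <= 6 * B * mu by rewrite ler_wpM2l// mulr_ge0.
  lra.
have -> : 12 * B = 6 * B + 6 * B by ring.
by apply: norm_complex_le; exact: part.
Qed.

Lemma norm_phi_le n q : B <= 2^-1 ->
  `|phi L0 W f q| ^+ n <= (fourier_abs f (freqvec q) ^+ n + n%:R * (12 * B))%:C.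
Proof.
move=> B2; have B0 : 0 <= B by rewrite mulr_ge0 ?powR_ge0 ?(ltW tail_const_gt0).
have := norm_phi_le1 L0 tau1 W0 df f0 q; have := phi_close q B2.
have : `|phi L0 W f q| <= `|fhat (freqvec q)| + `|phi L0 W f q - fhat (freqvec q)|.
  by rewrite -lerBlDl lerB_dist.
rewrite fhat_norm [`|phi L0 W f q|]normc_def; set s := Num.sqrt _ => h1 h2 h3.
have s1 : 0 <= s <= 1 by rewrite sqrtr_ge0 -lecR.
have h4 : s <= fourier_abs f (freqvec q) + 12 * B.
  rewrite -lecR rmorphD; apply: le_trans h1 _; by rewrite lerD2l.
rewrite -rmorphXn lecR; apply: expr_le_add => //.
  by rewrite fourier_abs_ge0 fourier_abs_le1.
by rewrite mulr_ge0.
Qed.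

End FixedScale.

Lemma pn_estimate : exists C C' : R, [/\ 0 < C, 0 < C' &
  forall (L : nat) (hL : (0 < L)%N) (W : R), 0 < W ->
  forall n : nat, (0 < n)%N -> forall x : Lam d L,
  `| pn f W n (lam0 d hL) x - ((L ^ d)%:R)^-1 |
    <= C * W `^ (- d%:R) * n%:R `^ (- (d%:R / alpha)) + C' * n%:R * W `^ (- K)].
Proof.
have [D D0 hD] := fourier_pow_decay.
pose C3 := 2 `^ K * S ^+ d.
have C30 : 0 < C3 by rewrite mulr_gt0 ?powR_gt0 ?exprn_gt0.
(* The 2 counts the two terms of [fourier_pow_decay], each summing to the same order; 12 B is the
   error in [phi_close]. *)
exists (2 * D * C3), (12 * tail_const); split.
- by apply: mulr_gt0 => //; exact: mulr_gt0.
- by rewrite mulr_gt0// tail_const_gt0.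
move=> L L0 W W0 n n0 x.
set B := tail_const * W `^ (- K); set N := ((L ^ d)%:R : R).
have B0 : 0 < B by rewrite mulr_gt0 ?powR_gt0 ?tail_const_gt0.
have nR : 0 < n%:R :> R by rewrite ltr0n.
have n1 : 1 <= n%:R :> R by rewrite ler1n.
have LR : 0 < L%:R :> R by rewrite ltr0n.
have N0 : 0 < N by rewrite ltr0n expn_gt0 L0.
have -> : 12 * tail_const * n%:R * W `^ (- K) = n%:R * (12 * B) by rewrite /B; ring.
(* For B > 1/2 the error term exceeds 6 n, while both numbers compared lie in [0, 1]. *)
have [B2|B2] := leP B 2^-1; last first.
  have p0 := pn_ge0 tau1 W0 f_dominated f0 n (lam0 d L0) x.
  have p1 := pn_le1 L0 tau1 W0 f_dominated f0 n (lam0 d L0) x.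
  have Ni1 : N^-1 <= 1 by rewrite invf_le1// /N ler1n expn_gt0 L0.
  have Ni0 : 0 <= N^-1 by rewrite invr_ge0 ltW.
  apply: (@le_trans _ _ (n%:R * (12 * B))); last first.
    have DC : 0 <= 2 * D * C3 by apply: mulr_ge0; [apply: mulr_ge0 => //|]; exact: ltW.
    by rewrite lerDr; apply: mulr_ge0; [apply: mulr_ge0|]; rewrite ?powR_ge0.
  have : 1 * (12 * B) <= n%:R * (12 * B) by rewrite ler_wpM2r// mulr_ge0// ltW.
  rewrite ler_norml; lra.
have M0 : lattice_sum W f != 0.
  apply/eqP => e; have := mass_close L0 W0; rewrite e mulr0 sub0r normrN normr1 -/B; lra.
set E1 := n%:R `^ (- (d%:R / alpha)).
pose lam := n%:R `^ alpha^-1.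
have lam0_ : 0 < lam by exact: powR_gt0.
pose v (q : Lam d L) : 'rV[R]_d := \row_i (symres (q i))%:~R.
have vE q : enorm (freqvec W q) = W / L%:R * enorm (v q).
  rewrite -enormZ ?divr_ge0 ?(ltW W0)//; congr enorm.
  by apply/rowP => i; rewrite !mxE.
have WL0 : 0 < W / L%:R by rewrite divr_gt0.
pose b (q : Lam d L) := D * ((1 + lam * (W / L%:R) * enorm (v q)) `^ (- K) +
   E1 * (1 + W / L%:R * enorm (v q)) `^ (- K)) + n%:R * (12 * B).
have hb q : q != lam0 d L0 -> `|phi L0 W f q| ^+ n <= (b q)%:C.
  move=> _; apply: le_trans (norm_phi_le L0 W0 n q B2) _; rewrite lecR lerD2r.
  apply: le_trans (hD n n0 _) _; rewrite vE.
  by rewrite -/lam -/E1 [lam * (_ * _)]mulrA.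
apply: le_trans (pn_distance tau1 W0 f_dominated f0 x M0 hb) _.
(* At scale n^(1/alpha) W / L the bound s^-d becomes n^(-d/alpha) W^-d N; at scale W / L it is W^-d
   N, and E1 supplies the missing power of n. *)
have s1 := sum_symres L0 d0 dK (mulr_gt0 lam0_ WL0).
have s2 := sum_symres L0 d0 dK WL0.
rewrite -/kap -/S -/C3 in s1 s2.
have Wpow (s : R) : 0 < s -> s^-1 ^+ d = s `^ (- d%:R).
  by move=> s0; rewrite powRN powR_mulrn ?(ltW s0)// exprVn.
have E1E : E1 = lam^-1 ^+ d.
  by rewrite Wpow// /lam -powRrM /E1; congr (_ `^ _); rewrite mulrN mulrC.
have e1 : (W / L%:R)^-1 ^+ d = W `^ (- d%:R) * N.
  by rewrite -Wpow// invfM invrK exprMn /N natrX.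
have e2 : (lam * (W / L%:R))^-1 ^+ d = E1 * W `^ (- d%:R) * N.
  by rewrite invfM exprMn e1 -E1E mulrA.
rewrite e1 in s2; rewrite e2 in s1.
apply: (@le_trans _ _ (N^-1 * (D * (C3 * (E1 * W `^ (- d%:R) * N) + E1 * (C3 * (W `^ (- d%:R) * N))) + N * (n%:R * (12 * B))))).
  rewrite ler_wpM2l ?invr_ge0 ?(ltW N0)// /b big_split/= -mulr_sumr big_split/= -mulr_sumr lerD//.
    apply: ler_wpM2l; first exact: ltW.
    apply: lerD; first exact: s1.
    by apply: ler_wpM2l; [exact: powR_ge0|exact: s2].
  apply: (@le_trans _ _ (\sum_(q : Lam d L) n%:R * (12 * B))).
    rewrite [leRHS](bigID (fun q => q != lam0 d L0))/= lerDl sumr_ge0// => q _.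
    by apply: mulr_ge0; [exact: ltW|apply: mulr_ge0 => //; exact: ltW].
  by rewrite sumr_const card_ffun !card_ord -[leLHS]mulr_natl.
rewrite le_eqVlt; apply/orP; left; apply/eqP; rewrite -/E1.
by field; rewrite gt_eqF.
Qed.

End MainEstimate.

Local Close Scope complex_scope.
Local Close Scope classical_set_scope.

Theorem theoremD1 (R : realType) (d : nat) (f : 'rV[R]_d -> R)
    (alpha c0 eps rho T K CT CK : R) :
  (0 < d)%N ->
  0 < alpha <= 2 -> 0 < c0 -> 0 < eps -> 0 < rho < 1 ->
  (* (1) *)
  (forall u, 0 <= f u) -> iint f = 1 ->
  (* (2) *)
  (forall xi, enorm xi <= eps -> fourier_abs f xi <= expR (- (c0 * enorm xi `^ alpha))) ->
  (* (3) *)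
  (forall xi, eps < enorm xi -> fourier_abs f xi <= rho) ->
  (* (4) *)
  continuous f -> d%:R < T -> d%:R < K -> 1 < CT -> 1 < CK ->
  (forall u, f u <= CT * (1 + enorm u) `^ (- T)) ->
  (forall xi, fourier_abs f xi <= CK * (1 + enorm xi) `^ (- K)) ->
  exists C C' : R, 0 < C /\ 0 < C' /\
    forall (L : nat) (hL : (0 < L)%N) (W : R), 0 < W ->
    forall (n : nat), (0 < n)%N -> forall x : Lam d L,
      `| pn f W n (lam0 d hL) x - ((L ^ d)%:R)^-1 |
          <= C * W `^ (- d%:R) * n%:R `^ (- (d%:R / alpha)) + C' * n%:R * W `^ (- K)
      /\ (n%:R * W `^ (- K) <= ((L ^ d)%:R)^-1 ->
          pn f W n (lam0 d hL) x
            <= C * (W `^ (- d%:R) * n%:R `^ (- (d%:R / alpha)) + ((L ^ d)%:R)^-1)).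
Proof.
move=> d0 /andP[alpha0 _] c0_gt0 _ rho01 f0 f_int f_small f_large f_cont dT dK _ CK1 f_decay f_fourier.
have CK0 : 0 < CK by exact: lt_trans CK1.
have [C [C' [C0 C'0 H]]] := pn_estimate d0 alpha0 c0_gt0 rho01 f0 f_int f_small f_large
  f_cont dT dK CK0 f_decay f_fourier.
(* With X = W^-d n^(-d/alpha), the smallness assumption gives p_n <= 1/N + C X + C'/N. The constant
   C + C' + 1 absorbs this and still serves in the first bound. *)
exists (C + C' + 1), C'; split; first by rewrite addr_gt0// addr_gt0.
split=> // L hL W W0 n n0 x; have h := H L hL W W0 n n0 x.
set X := W `^ (- d%:R) * n%:R `^ (- (d%:R / alpha)).
have X0 : 0 <= X by rewrite mulr_ge0 ?powR_ge0.
have hX (c : R) : c * W `^ (- d%:R) * n%:R `^ (- (d%:R / alpha)) = c * X by rewrite /X mulrA.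
rewrite !hX in h *; set Y := C' * n%:R * _ in h *.
have C'X : 0 <= C' * X by rewrite mulr_ge0 ?(ltW C'0).
split=> [|small]; first by apply: le_trans h _; rewrite lerD2r !mulrDl mul1r; lra.
set N := ((L ^ d)%:R)^-1 in h small *.
have N0 : 0 <= N by rewrite invr_ge0.
have hY : Y <= C' * N by rewrite /Y -mulrA ler_wpM2l ?(ltW C'0).
have CN : 0 <= C * N by rewrite mulr_ge0 ?(ltW C0).
have := ler_norm (pn f W n (lam0 d hL) x - N); rewrite !mulrDr !mulrDl !mul1r; lra.
Qed.
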